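(* Let $H$ be a Hilbert space, $d_1,\dots,d_k\ge1$, and for each $i,j\in\{1,\dots,k\}$ let $u^{(i,j)}=(u^{(i,j)}_{(q,m)(p,l)})_{(q,m),(p,l)\in[d_i]\times[d_j]}$ be a unitary matrix such that the induced maps $t_{i,j}$ satisfy $t_{i,i}=\mathrm{id}$, $t_{j,i}=t_{i,j}^{-1}$ and the associativity condition $(t_{j,i}\otimes I_{E_l})(I_{E_j}\otimes t_{l,i})(t_{l,j}\otimes I_{E_i})=(I_{E_i}\otimes t_{l,j})(t_{l,i}\otimes I_{E_j})(I_{E_l}\otimes t_{j,i})$ for all $i,j,l$. Let $T^{(1)},\dots,T^{(k)}$ be row contractions on $H$, $T^{(i)}$ of length $d_i$, such that for all $i\neq j$ the pair $(T^{(i)},T^{(j)})$ $u^{(i,j)}$-doubly commutes. Then there exist a Hilbert space $K\supseteq H$ and row isometries $V^{(1)},\dots,V^{(k)}$ on $K$, $V^{(i)}$ of length $d_i$, such that for all $i\neq j$ the pair $(V^{(i)},V^{(j)})$ $u^{(i,j)}$-doubly commutes, and the representation of $X$ determined by the $V^{(i)}$ is a (minimal) regular isometric dilation of the representation determined by the $T^{(i)}$.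
   Context: $[m]=\{1,\dots,m\}$. $E_i$ is a Hilbert space of dimension $d_i$ with orthonormal basis $\{e^{(i)}_l\}_{l\in[d_i]}$ (a $C^*$-correspondence over $\mathbb C$). $t_{i,j}:E_i\otimes E_j\to E_j\otimes E_i$ is defined by $t_{i,j}(e^{(i)}_q\otimes e^{(j)}_m)=\sum_{(p,l)\in[d_i]\times[d_j]}u^{(i,j)}_{(q,m)(p,l)}\,e^{(j)}_l\otimes e^{(i)}_p$. $X$ is the product system over $\mathbb Z_+^k$ with $X(\mathbf n)=E_1^{\otimes n_1}\otimes\cdots\otimes E_k^{\otimes n_k}$, $X(\mathbf 0)=\mathbb C$, whose multiplication reorders factors via the $t_{i,j}$ (with $\theta_{\mathbf e_i,\mathbf e_j}=\mathrm{id}$ for $i\le j$ and $=t_{i,j}$ for $i>j$). A row contraction of length $n$ on $H$ is $T=(T_1,\dots,T_n)$, $T_i\in B(H)$, with $\sum_iT_iT_i^*\le I$; a row isometry is a row contraction with each $T_i$ an isometry. For a unitary $u$ of size $nm$ indexed by $[n]\times[m]$, row contractions $T$ (length $n$) and $S$ (length $m$) $u$-doubly commute if for all $q\in[n]$, $r\in[m]$: (a) $T_qS_r=\sum_{(p,l)\in[n]\times[m]}u_{(q,r)(p,l)}S_lT_p$ and (b) $S_r^*T_q=\sum_{(p,l)\in[n]\times[m]}u_{(q,l)(p,r)}T_pS_l^*$. A $k$-tuple of row contractions $T^{(i)}=(T^{(i)}_1,\dots,T^{(i)}_{d_i})$ satisfying (a) for all pairs determines a representation of $X$ by $T^{(i)}(e^{(i)}_l)=T^{(i)}_l$,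 extended linearly; for $\mathbf n\in\mathbb Z_+^k$, $\tilde T_{\mathbf n}:X(\mathbf n)\otimes H\to H$, $\tilde T_{\mathbf n}(\xi^{(1)}_1\otimes\cdots\otimes\xi^{(k)}_{n_k}\otimes h)=T^{(1)}(\xi^{(1)}_1)\cdots T^{(k)}(\xi^{(k)}_{n_k})h$, $\tilde T_{\mathbf 0}=I$; for $\mathbf n\in\mathbb Z^k$, $\mathbf n_+$ has entries $\max(n_i,0)$, $\mathbf n_-=\mathbf n_+-\mathbf n$, and $T(\mathbf n)=\tilde T_{\mathbf n_-}^*\tilde T_{\mathbf n_+}$. Representation $V$ on $K\supseteq H$ is a regular isometric dilation of $T$ if each $V^{(i)}$ is a row isometry, $H$ is invariant under all $V^{(i)*}_l$, and $(I_{X(\mathbf n_-)}\otimes P_H)V(\mathbf n)|_{X(\mathbf n_+)\otimes H}=T(\mathbf n)$ for all $\mathbf n\in\mathbb Z^k$; minimal if $K$ is the smallest closed subspace containing $H$ invariant under all $V^{(i)}_l$. *)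

(* Defs.v *)
(* Scalars: C = R[i] (complex numbers over a realType R). *)
From HB Require Import structures.
From mathcomp Require Import all_boot all_order all_algebra.
From mathcomp Require Import reals.
From mathcomp.real_closed Require Import complex.
Set Implicit Arguments. Unset Strict Implicit. Unset Printing Implicit Defensive.
Import Order.TTheory GRing.Theory Num.Theory.
Local Open Scope ring_scope.

Section Hilbert.
Variable R : realType.
Local Notation C := (R[i]).

(** ** Complex Hilbert spaces: an lmodType over C with an inner product
    (linear in the first variable), complete for the induced norm. *)
Definition dist2 (V : lmodType C) (ip : V -> V -> C) (x y : V) : C :=
  ip (x - y) (x - y).

Definition cauchy_seq (V : lmodType C) (ip : V -> V -> C) (s : nat -> V) : Prop :=
  forall eps : C, 0 < eps -> exists N : nat, forall m n : nat,
    (N <= m)%N -> (N <= n)%N -> dist2 ip (s m) (s n) < eps.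

Definition converges_to (V : lmodType C) (ip : V -> V -> C) (s : nat -> V) (l : V) : Prop :=
  forall eps : C, 0 < eps -> exists N : nat, forall n : nat,
    (N <= n)%N -> dist2 ip (s n) l < eps.

Definition is_hilbert (V : lmodType C) (ip : V -> V -> C) : Prop :=
  [/\ (forall (a : C) (x y z : V), ip (a *: x + y) z = a * ip x z + ip y z),
      (forall x y : V, ip y x = (ip x y)^*),
      (forall x : V, 0 <= ip x x),
      (forall x : V, ip x x = 0 -> x = 0) &
      (forall s : nat -> V, cauchy_seq ip s -> exists l, converges_to ip s l)].

(** [S] is the (Hilbert space) adjoint of [T] : V -> W.  On Hilbert spaces
    an everywhere defined operator having an everywhere defined adjoint is
    automatically linear and bounded (Hellinger--Toeplitz), so this encodes
    "T is in B(V,W) and S = T^*". *)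
Definition adjoint_pair (V W : lmodType C) (ipV : V -> V -> C) (ipW : W -> W -> C)
  (T : V -> W) (S : W -> V) : Prop :=
  forall (x : V) (y : W), ipW (T x) y = ipV x (S y).

(** ** Row contractions / row isometries (with adjoints given as data) *)
Definition row_contraction (V : lmodType C) (ip : V -> V -> C) (n : nat)
  (T Tadj : 'I_n -> V -> V) : Prop :=
  (forall q, adjoint_pair ip ip (T q) (Tadj q)) /\
  (forall x : V, ip (\sum_(q < n) T q (Tadj q x)) x <= ip x x).

Definition row_isometry (V : lmodType C) (ip : V -> V -> C) (n : nat)
  (T Tadj : 'I_n -> V -> V) : Prop :=
  row_contraction ip T Tadj /\ (forall q (x : V), ip (T q x) (T q x) = ip x x).

(** ** Unitary matrices indexed by a finite type *)
Definition unitary_mx (I : finType) (u : I -> I -> C) : Prop :=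
  (forall a a' : I, \sum_(b : I) u a b * (u a' b)^* = (a == a')%:R) /\
  (forall a a' : I, \sum_(b : I) (u b a)^* * u b a' = (a == a')%:R).

(** ** u-double commutation of T (length n) and S (length m) *)
Definition u_doubly_commute (V : lmodType C) (n m : nat)
  (u : 'I_n * 'I_m -> 'I_n * 'I_m -> C)
  (T Tadj : 'I_n -> V -> V) (S Sadj : 'I_m -> V -> V) : Prop :=
  (forall (q : 'I_n) (r : 'I_m) (x : V),
      T q (S r x) = \sum_(pl : 'I_n * 'I_m) u (q, r) pl *: S pl.2 (T pl.1 x)) /\
  (forall (q : 'I_n) (r : 'I_m) (x : V),
      Sadj r (T q x) = \sum_(pl : 'I_n * 'I_m) u (q, pl.2) (pl.1, r) *: T pl.1 (Sadj pl.2 x)).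

(** ** Linear maps between finite-dimensional spaces C^I, given by kernels.
    A vector of C^I is its coefficient function on the orthonormal basis. *)
Definition kapp (I J : finType) (M : I -> J -> C) (x : I -> C) : J -> C :=
  fun j => \sum_(i : I) x i * M i j.

(** M (x) I_E  on  (A*B)*E  *)
Definition kL (A B A' B' E : finType) (M : A * B -> A' * B' -> C) :
  A * B * E -> A' * B' * E -> C :=
  fun x y => M (x.1.1, x.1.2) (y.1.1, y.1.2) * (x.2 == y.2)%:R.

(** I_E (x) M  on  E*(A*B), written left-associated as (E*A)*B  *)
Definition kR (E A B A' B' : finType) (M : A * B -> A' * B' -> C) :
  E * A * B -> E * A' * B' -> C :=
  fun x y => (x.1.1 == y.1.1)%:R * M (x.1.2, x.2) (y.1.2, y.2).

(** The flip map t_{i,j} : E_i (x) E_j -> E_j (x) E_i as a kernel: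
    t(e_q (x) e_m) = sum_{(p,l)} u_{(q,m)(p,l)} e_l (x) e_p. *)
Definition tker (di dj : nat) (u : 'I_di * 'I_dj -> 'I_di * 'I_dj -> C) :
  'I_di * 'I_dj -> 'I_dj * 'I_di -> C :=
  fun a b => u a (b.2, b.1).

(** ** Words in X(n) = E_1^{(x) n_1} (x) ... (x) E_k^{(x) n_k}.
    The orthonormal basis of X(n) is indexed by [words d n]; an element of
    X(n) (x) H is a function [words d n -> H]. *)
Definition words (k : nat) (d : 'I_k -> nat) (n : 'I_k -> nat) : finType :=
  {dffun forall i : 'I_k, (n i).-tuple 'I_(d i)}.

(** A_w = A^{(1)}_{w_{1,1}} ... A^{(1)}_{w_{1,n_1}} ... A^{(k)}_{w_{k,n_k}} *)
Definition wordop (V : Type) (k : nat) (d : 'I_k -> nat) (n : 'I_k -> nat)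
  (A : forall i : 'I_k, 'I_(d i) -> V -> V) (w : words d n) : V -> V :=
  foldr (fun i f => foldr (fun l g => A i l \o g) f (tval (w i))) id (enum 'I_k).

(** (A_w)^* = (A^{(k)}_{w_{k,n_k}})^* ... (A^{(1)}_{w_{1,1}})^* *)
Definition wordadj (V : Type) (k : nat) (d : 'I_k -> nat) (n : 'I_k -> nat)
  (Aadj : forall i : 'I_k, 'I_(d i) -> V -> V) (w : words d n) : V -> V :=
  foldr (fun i f => f \o foldr (fun l g => g \o Aadj i l) id (tval (w i))) id (enum 'I_k).

(** \tilde A_n : X(n) (x) V -> V *)
Definition tildeop (V : lmodType C) (k : nat) (d : 'I_k -> nat) (n : 'I_k -> nat)
  (A : forall i : 'I_k, 'I_(d i) -> V -> V) (f : words d n -> V) : V :=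
  \sum_(w : words d n) wordop A w (f w).

(** \tilde A_n^* : V -> X(n) (x) V *)
Definition tildeadj (V : lmodType C) (k : nat) (d : 'I_k -> nat) (n : 'I_k -> nat)
  (Aadj : forall i : 'I_k, 'I_(d i) -> V -> V) (x : V) : words d n -> V :=
  fun w => wordadj Aadj w x.

(** n_+ and n_- for n in Z^k *)
Definition npos (k : nat) (n : 'I_k -> int) : 'I_k -> nat :=
  fun i => match n i with Posz m => m | Negz _ => 0%N end.
Definition nneg (k : nat) (n : 'I_k -> int) : 'I_k -> nat :=
  fun i => match n i with Posz _ => 0%N | Negz m => m.+1 end.

(** A(n) = \tilde A_{n_-}^* \tilde A_{n_+} : X(n_+) (x) V -> X(n_-) (x) V *)
Definition repZ (V : lmodType C) (k : nat) (d : 'I_k -> nat)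
  (A Aadj : forall i : 'I_k, 'I_(d i) -> V -> V) (n : 'I_k -> int)
  (f : words d (npos n) -> V) : words d (nneg n) -> V :=
  tildeadj Aadj (tildeop A f).

(** closed linear subspaces *)
Definition closed_subspace (V : lmodType C) (ip : V -> V -> C) (S : V -> Prop) : Prop :=
  [/\ S 0,
      (forall x y, S x -> S y -> S (x + y)),
      (forall (a : C) x, S x -> S (a *: x)) &
      (forall (s : nat -> V) (l : V), (forall m, S (s m)) -> converges_to ip s l -> S l)].

End Hilbert.

Arguments repZ {R V k d} A Aadj n f _.

(* Main.v *)
Require Import Defs.
From HB Require Import structures.
From mathcomp Require Import all_boot all_order all_algebra.
From mathcomp Require Import generic_quotient ring_quotient.
From mathcomp Require Import boolp classical_sets functions reals.
From mathcomp.real_closed Require Import complex.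
From mathcomp Require Import ring lra.
Set Implicit Arguments. Unset Strict Implicit. Unset Printing Implicit Defensive.
Import Order.TTheory GRing.Theory Num.Theory.
Local Open Scope ring_scope.

(** The row contractions are dilated one index at a time, on modules carrying
    only a semi-inner product; a single Hausdorff completion at the end produces
    the Hilbert space.

    For the index [i], with [E = C^(d i)], the new module is
    [H (+) F(E) (x) (E (x) H)], where [E (x) H] carries the defect form
    [<x, y> - <T~ x, T~ y>].  Its vectors are the finitely supported functions
    [x : seq 'I_(d i) -> H]: [x [::]] is the component in [H] and [x (rcons w l)]
    the component of [e_w (x) (e_l (x) H)].  There [T^(i)] becomes the row
    isometry [h |-> T_l h + e_l (x) h], [e_w (x) z |-> e_l (x) e_w (x) z], whose
    adjoint is again explicit.  The other [T^(j)] extend by pushing them through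
    the letters of a word with the unitaries [u^(j,i)]; the braid identity for
    the [t_(i,j)] gives the double commutation of the extensions.  They remain
    row contractions for the defect form by Reid's inequality: an operator which
    is symmetric for a form dominated by [<.,.>] and contractive for [<.,.>] is
    contractive for that form.  No square root of the defect operator is needed.

    Regularity is automatic: by double commutation the adjoints [V_w^*] move
    past [V_v] when [v] and [w] involve disjoint sets of indices, with the same
    coefficients as for [T], and [V_l^* J = J T_l^*]. *)

(** * Semi-inner products and Reid's inequality *)

Section LinearFacts.
Variables (C : comNzRingType) (U V : lmodType C) (f : U -> V).
Hypothesis lf : linear f.

Definition linear_pack : {linear U -> V} :=
  HB.pack f (GRing.isLinear.Build C U V *:%R f lf).

Lemma lin0 : f 0 = 0. Proof. exact: (linear0 linear_pack). Qed.
Lemma linD x y : f (x + y) = f x + f y. Proof. exact: (linearD linear_pack). Qed.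
Lemma linB x y : f (x - y) = f x - f y. Proof. exact: (linearB linear_pack). Qed.
Lemma linZ a x : f (a *: x) = a *: f x. Proof. exact: (linearZZ linear_pack). Qed.
Lemma lin_sum (I : Type) (r : seq I) (P : pred I) (F : I -> U) :
  f (\sum_(i <- r | P i) F i) = \sum_(i <- r | P i) f (F i).
Proof. exact: (linear_sum linear_pack). Qed.

End LinearFacts.

Lemma linear_sum_fun (C : comNzRingType) (U V : lmodType C) (I : finType)
    (f : I -> U -> V) :
  (forall i, linear (f i)) -> linear (fun x => \sum_i f i x).
Proof.
move=> lf a x y; rewrite scaler_sumr -big_split /=.
by apply: eq_bigr => i _; exact: lf.
Qed.

Section SemiInnerProduct.
Variable C : numClosedFieldType.

Record semi_ip (V : lmodType C) (F : V -> V -> C) : Prop := SemiIp {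
  sip_lin : forall (a : C) x y z, F (a *: x + y) z = a * F x z + F y z;
  sip_sym : forall x y, F y x = (F x y)^*;
  sip_ge0 : forall x, 0 <= F x x }.

Variables (V : lmodType C) (F : V -> V -> C).
Hypothesis hF : semi_ip F.

Lemma sip_linl z : linear ((fun x => F x z) : V -> C^o).
Proof. by move=> a x y; exact: sip_lin. Qed.

Lemma sip0l z : F 0 z = 0. Proof. exact: (lin0 (sip_linl z)). Qed.
Lemma sipDl x y z : F (x + y) z = F x z + F y z.
Proof. exact: (linD (sip_linl z)). Qed.
Lemma sipBl x y z : F (x - y) z = F x z - F y z.
Proof. exact: (linB (sip_linl z)). Qed.
Lemma sipZl a x z : F (a *: x) z = a * F x z.
Proof. exact: (linZ (sip_linl z)). Qed.
Lemma sip_suml I (r : seq I) (P : pred I) (G : I -> V) z :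
  F (\sum_(i <- r | P i) G i) z = \sum_(i <- r | P i) F (G i) z.
Proof. exact: (lin_sum (sip_linl z)). Qed.

Lemma sipDr x y z : F z (x + y) = F z x + F z y.
Proof. by rewrite sip_sym // sipDl rmorphD /= -!sip_sym. Qed.
Lemma sipBr x y z : F z (x - y) = F z x - F z y.
Proof. by rewrite sip_sym // sipBl rmorphB /= -!sip_sym. Qed.
Lemma sipZr a x z : F z (a *: x) = a^* * F z x.
Proof. by rewrite sip_sym // sipZl rmorphM /= -!sip_sym. Qed.
Lemma sip_sumr I (r : seq I) (P : pred I) (G : I -> V) z :
  F z (\sum_(i <- r | P i) G i) = \sum_(i <- r | P i) F z (G i).
Proof.
rewrite sip_sym // sip_suml rmorph_sum /=.
by apply: eq_bigr => i _; rewrite -sip_sym.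
Qed.

Lemma sip_normB x y : F (x - y) (x - y) = F x x + F y y - (F x y + (F x y)^*).
Proof. by rewrite !(sipBl, sipBr) [F y x]sip_sym //; ring. Qed.

(** The form may be degenerate. If [F y y] is positive, test positivity on
    [F y y *: x - F x y *: y]; if only [F x x] is positive, exchange the vectors. If both vanish,
    [x - F x y *: y] gives [-2 |F x y|^2 >= 0]. *)
Lemma cauchy_schwarz x y : `|F x y| ^+ 2 <= F x x * F y y.
Proof.
have key (a b : V) : 0 < F b b -> `|F a b| ^+ 2 <= F a a * F b b.
  move=> b0; have rb : (F b b)^* = F b b by rewrite -sip_sym.
  have := sip_ge0 hF (F b b *: a - F a b *: b).
  rewrite !(sipBl, sipBr, sipZl, sipZr) rb [F b a](sip_sym hF a b).
  set c := F a b; set z := (X in 0 <= X).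
  have -> : z = F b b * (F a a * F b b - c * c^*) by rewrite /z; ring.
  by rewrite pmulr_rge0 // subr_ge0 normCK.
have := sip_ge0 hF y; rewrite le_eqVlt => /predU1P[y0|]; last exact: key.
have := sip_ge0 hF x; rewrite le_eqVlt => /predU1P[x0|]; last first.
  by move=> /(key y); rewrite [F y x](sip_sym hF x y) norm_conjC mulrC.
have := sip_ge0 hF (x - F x y *: y).
rewrite sip_normB -x0 !(sipZl, sipZr) -y0 !mulr0 !add0r oppr_ge0.
rewrite rmorphM /= conjCK -normCK mulrC -normCK -mulr2n.
by rewrite pmulrn_lle0.
Qed.

Lemma sip_bound x y a b : 0 <= a -> 0 <= b ->
  F x x <= a ^+ 2 -> F y y <= b ^+ 2 -> `|F x y| <= a * b.
Proof.
move=> a0 b0 xa yb; rewrite -ler_sqr ?nnegrE ?mulr_ge0 //.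
by rewrite (le_trans (cauchy_schwarz x y)) // exprMn ler_pM // sip_ge0.
Qed.

End SemiInnerProduct.

(** The algebraic part runs over an abstract closed numeric field, which need not be Archimedean.
    Reid's inequality requires this property there; [complex_archimedean] supplies it for [R[i]]. *)
Definition archimedean_axiom (C : numDomainType) :=
  forall x : C, 0 <= x -> exists n : nat, x < n%:R.

Section Reid.
Variable C : numClosedFieldType.
Hypothesis arch : archimedean_axiom C.

Lemma le_half_sum (a b c : C) : 0 <= a -> 0 <= b -> 0 <= c ->
  b ^+ 2 <= a * c -> b *+ 2 <= a + c.
Proof.
move=> a0 b0 c0 h; rewrite -ler_sqr ?nnegrE ?mulrn_wge0 ?addr_ge0 //.
have -> : (b *+ 2) ^+ 2 = b ^+ 2 *+ 4 by ring.
rewrite (@le_trans _ _ ((a * c) *+ 4)) ?lerMn2r ?h //.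
have -> : (a + c) ^+ 2 = (a - c) ^+ 2 + (a * c) *+ 4 by ring.
by rewrite lerDr real_exprn_even_ge0 // rpredB ?ger0_real.
Qed.

(** By the arithmetic-geometric mean inequality a log-convex sequence is convex, so its increments
    never fall below the first one. Were that one positive, the sequence would grow at least
    linearly, against the bound [c]. *)
Lemma logconvex_bounded_le (b : nat -> C) (c : C) :
    (forall m, 0 <= b m) -> (forall m, b m.+1 ^+ 2 <= b m * b m.+2) ->
    (forall m, b m <= c) -> b 1%N <= b 0%N.
Proof.
move=> b0 lc bc; rewrite real_leNgt ?ger0_real //; apply/negP => lt01.
have dif m : b 1%N - b 0%N <= b m.+1 - b m.
  elim: m => // m /le_trans; apply.
  have h := le_half_sum (b0 m) (b0 m.+1) (b0 m.+2) (lc m).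
  rewrite -subr_ge0 (_ : _ - _ = b m + b m.+2 - b m.+1 *+ 2) ?subr_ge0 //.
  by ring.
have lin m : (b 1%N - b 0%N) *+ m <= b m.
  elim: m => [|m IH]; first by rewrite mulr0n.
  by rewrite mulrSr (le_trans (lerD IH (dif m))) // addrC subrK.
have e0 : 0 < b 1%N - b 0%N by rewrite subr_gt0.
have c0 : 0 <= c by exact: le_trans (b0 0%N) (bc 0%N).
have [n] := arch (divr_ge0 c0 (ltW e0)).
rewrite ltr_pdivrMr // mulr_natl => /lt_le_trans/(_ (lin n)).
by move=> /lt_le_trans/(_ (bc n)); rewrite ltxx.
Qed.

Variables (V : lmodType C) (F Q : V -> V -> C) (B : V -> V).
Hypotheses (hF : semi_ip F) (hQ : semi_ip Q).

(** Cauchy-Schwarz for the form [F (B x) y] at [x] and [B x] bounds [F (B x) (B x) ^+ 2] by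
    [F (B x) x * F (B (B x)) (B x)], hence by [F x x * F (B x) (B x)]; then one factor cancels. *)
Lemma contraction_of_le :
  (forall x y, F (B x) y = F x (B y)) -> (forall x, 0 <= F (B x) x) ->
  (forall x, F (B x) x <= F x x) -> linear B -> forall x, F (B x) (B x) <= F x x.
Proof.
move=> symB posB leB linB x.
have hB : semi_ip (fun x y => F (B x) y).
  split=> [a u v z|u v|u]; last exact: posB.
    by rewrite linB sip_lin.
  by rewrite symB sip_sym.
have := cauchy_schwarz hB x (B x).
have := sip_ge0 hF (B x); rewrite le_eqVlt => /predU1P[<- _|pos].
  exact: sip_ge0.
rewrite ger0_norm ?(ltW pos) // expr2 => h.
have := le_trans h (ler_wpM2l (posB x) (leB (B x))).
by rewrite ler_pM2r // => /le_trans; apply; exact: leB.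
Qed.

(** The numbers [Q (B^m x) (B^m x)] are log-convex in [m], by Cauchy-Schwarz for [Q] and the
    symmetry of [B], and bounded by [F x x], since [Q] is below [F] and [B] contracts [F]. Such a
    sequence cannot increase at its first step. *)
Lemma reid :
  (forall x y, Q (B x) y = Q x (B y)) -> (forall x, F (B x) (B x) <= F x x) ->
  (forall x, Q x x <= F x x) -> forall x, Q (B x) (B x) <= Q x x.
Proof.
move=> symB conB leQF x.
apply: (@logconvex_bounded_le (fun m => Q (iter m B x) (iter m B x)) (F x x)).
- by move=> m; exact: sip_ge0.
- move=> m /=; set y := iter m B x.
  have := cauchy_schwarz hQ (B (B y)) y.
  by rewrite [Q (B (B y)) y]symB ger0_norm ?sip_ge0 // mulrC.
- move=> m; apply: le_trans (leQF _) _.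
  by elim: m => //= m /(le_trans _); apply.
Qed.

End Reid.

(** * Pushing operators through words *)

Lemma big_triple (V : nmodType) (I J K : finType) (f : I -> J -> K -> V) :
  \sum_i \sum_j \sum_k f i j k = \sum_(t : I * J * K) f t.1.1 t.1.2 t.2.
Proof. by rewrite pair_bigA /= pair_bigA. Qed.

Lemma sum_delta (V : nmodType) (I : finType) (i : I) (f : I -> V) :
  \sum_j f j *+ (j == i) = f i.
Proof.
rewrite (bigD1 i) //= eqxx big1 ?addr0 // => j /negbTE ->.
by rewrite mulr0n.
Qed.

Section Amplification.
Variables (C : numClosedFieldType) (H : lmodType C) (L : finType).
Local Notation W := (seq L -> H).

Definition branch (x : W) (l : L) : W := fun w => x (l :: w).

Lemma branchP a x y l : branch (a *: x + y) l = a *: branch x l + branch y l.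
Proof. by []. Qed.

(** [c r l p l'] is the coefficient with which [S r], passing the letter [l], leaves the letter [l']
    and comes out as [S p]. The recursion runs along the output word; word length is preserved, as
    [amp_local] records. *)
Fixpoint amp (I : finType) (c : I -> L -> I -> L -> C) (S : I -> H -> H)
    (r : I) (x : W) (w : seq L) {struct w} : H :=
  if w is l' :: w' then
    \sum_p \sum_l c r l p l' *: amp c S p (branch x l) w'
  else S r (x [::]).

Section OneFamily.
Variables (I : finType) (c : I -> L -> I -> L -> C) (S : I -> H -> H).

Lemma branch_amp r x l' :
  branch (amp c S r x) l' = \sum_p \sum_l c r l p l' *: amp c S p (branch x l).
Proof.
apply/funext => w; rewrite fct_sumE; apply: eq_bigr => p _.
by rewrite fct_sumE.
Qed.

Lemma amp_local w r x y : (forall v, size v = size w -> x v = y v) ->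
  amp c S r x w = amp c S r y w.
Proof.
elim: w r x y => [|l' w IH] r x y xy /=; first by rewrite xy.
apply: eq_bigr => p _; apply: eq_bigr => l _; congr (_ *: _).
by apply: IH => v sv; rewrite /branch xy //= sv.
Qed.

Hypothesis linS : forall r, linear (S r).

Lemma amp_linear_at w r : linear (fun x => amp c S r x w).
Proof.
elim: w r => [|l' w IH] r; first by move=> a x y; exact: linS.
apply: (@linear_sum_fun _ _ _ _
  (fun p x => \sum_l c r l p l' *: amp c S p (branch x l) w)) => p.
apply: (@linear_sum_fun _ _ _ _
  (fun l x => c r l p l' *: amp c S p (branch x l) w)) => l a x y.
by rewrite branchP IH scalerDr !scalerA mulrC.
Qed.

Lemma amp_linear r : linear (amp c S r).
Proof. by move=> a x y; apply/funext => w; exact: amp_linear_at. Qed.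

Lemma amp_eq0 w r x : (forall v, size v = size w -> x v = 0) ->
  amp c S r x w = 0.
Proof.
move=> /(@amp_local _ r x 0) ->; exact: (lin0 (amp_linear_at w r)).
Qed.

End OneFamily.

Section TwoFamilies.
Variables (I J : finType) (c : I -> L -> I -> L -> C) (S : I -> H -> H).
Variables (c' : J -> L -> J -> L -> C) (S' : J -> H -> H).
Hypotheses (linS : forall r, linear (S r)) (linS' : forall r, linear (S' r)).

(** Induction on the word. The coefficient hypothesis is a Yang-Baxter relation carrying the
    exchange coefficients [k] past one letter. As [c], [c'] and [k] are independent parameters, the
    lemma serves both relation (a) and, with adjoints in place of [S], relation (b). *)
Lemma amp_comm (k : I -> J -> I -> J -> C) :
  (forall q r x, S q (S' r x) = \sum_p \sum_s k q r p s *: S' s (S p x)) ->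
  (forall q r l p2 s2 l2,
    \sum_q1 \sum_l1 \sum_r1 c q l1 q1 l2 * c' r l r1 l1 * k q1 r1 p2 s2
    = \sum_p \sum_s \sum_l1 k q r p s * c' s l1 s2 l2 * c p l p2 l1) ->
  forall q r x, amp c S q (amp c' S' r x)
    = \sum_p \sum_s k q r p s *: amp c' S' s (amp c S p x).
Proof.
move=> hS hk q r x; apply/funext => w; rewrite fct_sumE.
under [RHS]eq_bigr do rewrite fct_sumE.
change (amp c S q (amp c' S' r x) w
  = \sum_p \sum_s k q r p s *: amp c' S' s (amp c S p x) w).
elim: w q r x => [|l2 w IH] q r x /=; first exact: hS.
(* Both sides are expanded in the vectors [Z l p2 s2], so that only their coefficients remain to be
   compared. *)
pose Z l p2 s2 := amp c' S' s2 (amp c S p2 (branch x l)) w.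
transitivity (\sum_q1 \sum_l1 \sum_r1 \sum_l \sum_p2 \sum_s2
   (c q l1 q1 l2 * c' r l r1 l1 * k q1 r1 p2 s2) *: Z l p2 s2).
  apply: eq_bigr => q1 _; apply: eq_bigr => l1 _.
  rewrite branch_amp (lin_sum (amp_linear_at _ linS w q1)) scaler_sumr.
  apply: eq_bigr => r1 _.
  rewrite (lin_sum (amp_linear_at _ linS w q1)) scaler_sumr.
  apply: eq_bigr => l _.
  rewrite (linZ (amp_linear_at _ linS w q1)) IH scalerA scaler_sumr.
  apply: eq_bigr => p2 _; rewrite scaler_sumr; apply: eq_bigr => s2 _.
  by rewrite scalerA.
transitivity (\sum_p \sum_s \sum_l1 \sum_l \sum_p2 \sum_s2
   (k q r p s * c' s l1 s2 l2 * c p l p2 l1) *: Z l p2 s2); last first.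
  apply: eq_bigr => p _; apply: eq_bigr => s _.
  rewrite scaler_sumr; under [RHS]eq_bigr do rewrite scaler_sumr.
  rewrite [RHS]exchange_big; apply: eq_bigr => l1 _ /=.
  under eq_bigr do rewrite exchange_big.
  rewrite exchange_big; apply: eq_bigr => s2 _ /=.
  rewrite branch_amp (lin_sum (amp_linear_at _ linS' w s2)) scalerA scaler_sumr.
  rewrite exchange_big; apply: eq_bigr => p2 _ /=.
  rewrite (lin_sum (amp_linear_at _ linS' w s2)) scaler_sumr.
  apply: eq_bigr => l _.
  by rewrite (linZ (amp_linear_at _ linS' w s2)) scalerA.
rewrite [LHS]big_triple [RHS]big_triple; under eq_bigr do rewrite big_triple.
under [RHS]eq_bigr do rewrite big_triple.
rewrite exchange_big [RHS]exchange_big; apply: eq_bigr => -[[l p2] s2] _ /=.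
rewrite -!scaler_suml; congr (_ *: _).
rewrite -(big_triple (fun q1 l1 r1 => c q l1 q1 l2 * c' r l r1 l1 * k q1 r1 p2 s2)).
by rewrite hk big_triple.
Qed.

End TwoFamilies.

Section Isometries.
Variables (I : finType) (c c' : I -> L -> I -> L -> C) (S S' : I -> H -> H).
Hypotheses (linS : forall r, linear (S r)).

(** Applied with the adjoints as [S] and the operators as [S']: at each letter [c] undoes [c'], and
    the relation on [H] closes the induction at the empty word. *)
Lemma amp_isometry :
  (forall q r x, S q (S' r x) = x *+ (q == r)) ->
  (forall q r l l2, \sum_q1 \sum_l1 c q l1 q1 l2 * c' r l q1 l1
    = (q == r)%:R *+ (l == l2)) ->
  forall q r x, amp c S q (amp c' S' r x) = x *+ (q == r).
Proof.
move=> hS hc q r x; apply/funext => w.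
have -> : (x *+ (q == r)) w = x w *+ (q == r) by case: (q == r).
elim: w q r x => [|l2 w IH] q r x /=; first exact: hS.
transitivity (\sum_q1 \sum_l1 \sum_l (c q l1 q1 l2 * c' r l q1 l1) *: x (l :: w)).
  apply: eq_bigr => q1 _; apply: eq_bigr => l1 _.
  transitivity (c q l1 q1 l2 *:
      \sum_r1 (\sum_l c' r l r1 l1 *: x (l :: w)) *+ (r1 == q1)).
    rewrite branch_amp (lin_sum (amp_linear_at _ linS w q1)); congr (_ *: _).
    apply: eq_bigr => r1 _; rewrite (lin_sum (amp_linear_at _ linS w q1)).
    rewrite -sumrMnl; apply: eq_bigr => l _.
    by rewrite (linZ (amp_linear_at _ linS w q1)) IH scalerMnr eq_sym.
  by rewrite sum_delta scaler_sumr; under eq_bigr do rewrite scalerA.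
under eq_bigr do rewrite exchange_big /=.
rewrite exchange_big /= -(sum_delta l2 (fun l => x (l :: w) *+ (q == r))).
apply: eq_bigr => l _; under eq_bigr do rewrite -scaler_suml.
rewrite -scaler_suml hc -scaler_nat -mulrnA mulnC mulrnA.
by case: (_ == _); case: (_ == _); rewrite ?scale1r ?scale0r.
Qed.

End Isometries.

End Amplification.

Lemma semi_ip_sum (C : numClosedFieldType) (U V : lmodType C) (I : finType)
    (G : V -> V -> C) (g : I -> U -> V) :
  semi_ip G -> (forall i, linear (g i)) ->
  semi_ip (fun x y => \sum_i G (g i x) (g i y)).
Proof.
move=> hG lg; split=> [a x y z|x y|x].
- rewrite mulr_sumr -big_split /=; apply: eq_bigr => i _.
  by rewrite lg sip_lin.
- by rewrite rmorph_sum /=; apply: eq_bigr => i _; exact: sip_sym.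
- by apply: sumr_ge0 => i _; exact: sip_ge0.
Qed.

(** * Amplification by one letter: adjoints and row contractions *)

Section Lift.
Variables (C : numClosedFieldType) (X : lmodType C) (L I : finType).

(** One letter's worth of [amp], acting on [E (x) X]. By [branch_amp_lift1] the operator [amp]
    iterates it, so forms on words can be treated letter by letter. *)
Definition lift1 (c : I -> L -> I -> L -> C) (A : I -> X -> X) (r : I)
    (f : L -> X) : L -> X :=
  fun l' => \sum_p \sum_l c r l p l' *: A p (f l).

Variables (G : X -> X -> C) (c c' : I -> L -> I -> L -> C) (A A' : I -> X -> X).
Hypothesis hG : semi_ip G.

Lemma lift1_linear r : (forall p, linear (A p)) -> linear (lift1 c A r).
Proof.
move=> lA a f g; apply/funext => l'.
apply: (@linear_sum_fun _ _ _ _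
  (fun p f => \sum_l c r l p l' *: A p (f l))) => p.
apply: (@linear_sum_fun _ _ _ _
  (fun l f => c r l p l' *: A p (f l))) => l b x y.
by rewrite lA scalerDr !scalerA mulrC.
Qed.

Lemma lift1_adjoint r f g :
  (forall p x y, G (A p x) y = G x (A' p y)) ->
  (forall r l p l', c r l p l' = (c' r l' p l)^*) ->
  \sum_l G (lift1 c A r f l) (g l) = \sum_l G (f l) (lift1 c' A' r g l).
Proof.
move=> adjA cc'.
transitivity (\sum_l' \sum_p \sum_l c r l p l' * G (f l) (A' p (g l'))).
  apply: eq_bigr => l' _; rewrite (sip_suml hG); apply: eq_bigr => p _.
  rewrite (sip_suml hG); apply: eq_bigr => l _.
  by rewrite (sipZl hG) adjA.
under eq_bigr do rewrite exchange_big /=.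
rewrite exchange_big /=; apply: eq_bigr => l _.
rewrite exchange_big /= (sip_sumr hG); apply: eq_bigr => p _.
rewrite (sip_sumr hG); apply: eq_bigr => l' _.
by rewrite (sipZr hG) cc'.
Qed.

(** The vectors [lift1 c' A' r f l'] arise from the vectors [A' p (f l)] by a coefficient matrix
    which [unit_c] makes isometric. The total squared norm is therefore unchanged, and the row
    contraction bound applies for each [l]. *)
Lemma lift1_contraction f :
  (forall x, \sum_p G (A' p x) (A' p x) <= G x x) ->
  (forall l p l2 p2, \sum_r \sum_l' c' r l p l' * (c' r l2 p2 l')^*
     = ((l == l2) && (p == p2))%:R) ->
  \sum_r \sum_l G (lift1 c' A' r f l) (lift1 c' A' r f l) <= \sum_l G (f l) (f l).
Proof.
move=> conA unit_c.
apply: (@le_trans _ _ (\sum_l \sum_p G (A' p (f l)) (A' p (f l)))); last first.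
  by apply: ler_sum => l _; exact: conA.
suff -> : \sum_r \sum_l G (lift1 c' A' r f l) (lift1 c' A' r f l)
   = \sum_l \sum_p G (A' p (f l)) (A' p (f l)) by [].
pose Z (t t' : L * I) := G (A' t.2 (f t.1)) (A' t'.2 (f t'.1)).
have liftE r l' : lift1 c' A' r f l'
    = \sum_(t : L * I) c' r t.1 t.2 l' *: A' t.2 (f t.1).
  by rewrite /lift1 exchange_big pair_bigA.
transitivity (\sum_r \sum_l' \sum_(t : L * I) \sum_(t' : L * I)
    (c' r t.1 t.2 l' * (c' r t'.1 t'.2 l')^*) * Z t t').
  apply: eq_bigr => r _; apply: eq_bigr => l' _.
  rewrite liftE (sip_suml hG); apply: eq_bigr => t _.
  rewrite (sip_sumr hG); apply: eq_bigr => t' _.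
  by rewrite (sipZl hG) (sipZr hG) mulrA.
under eq_bigr do rewrite exchange_big /=.
rewrite exchange_big /= [RHS]pair_bigA /=; apply: eq_bigr => t _.
under eq_bigr do rewrite exchange_big /=.
rewrite exchange_big /= -[RHS]/(Z t t) -(sum_delta t (Z t)).
apply: eq_bigr => t' _.
under eq_bigr do rewrite -mulr_suml.
rewrite -mulr_suml unit_c [t' == t]eq_sym mulr_natl.
by case: t t' => [? ?] [? ?].
Qed.

End Lift.

(** * The defect form of a row contraction and the operators lifted to it *)

Section Row.
Variables (C : numClosedFieldType) (H : lmodType C) (F : H -> H -> C).
Variables (L : finType) (T T' : L -> H -> H).
Hypotheses (hF : semi_ip F) (linT : forall l, linear (T l)).
Hypothesis adjT : forall l x y, F (T l x) y = F x (T' l y).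
Hypothesis conT : forall x, \sum_l F (T' l x) (T' l x) <= F x x.

Definition rowop (f : L -> H) : H := \sum_l T l (f l).
Definition row_ip (f g : L -> H) : C := \sum_l F (f l) (g l).
Definition defect_ip (f g : L -> H) : C := row_ip f g - F (rowop f) (rowop g).

Lemma rowop_linear : linear rowop.
Proof. by apply: (@linear_sum_fun _ _ _ _ (fun l f => T l (f l))) => l a f g; exact: linT. Qed.

Lemma row_ip_semi : semi_ip row_ip.
Proof. exact: (@semi_ip_sum _ _ _ _ _ (fun (l : L) (f : L -> H) => f l)). Qed.

Lemma rowop_adjoint f y : F (rowop f) y = row_ip f (fun l => T' l y).
Proof. by rewrite (sip_suml hF); apply: eq_bigr => l _; exact: adjT. Qed.

(** The hypothesis bounds [T~ T~^*] while the conclusion bounds [T~^* T~]. Cauchy-Schwarz between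
    [f] and [T~^* T~ f] passes from one to the other. *)
Lemma rowop_contraction f : F (rowop f) (rowop f) <= row_ip f f.
Proof.
have := sip_ge0 hF (rowop f); rewrite le_eqVlt => /predU1P[<-|pos].
  exact: (sip_ge0 row_ip_semi).
have := cauchy_schwarz row_ip_semi f (fun l => T' l (rowop f)).
rewrite -rowop_adjoint ger0_norm ?(ltW pos) // => h.
have := le_trans h (ler_wpM2l (sip_ge0 row_ip_semi f) (conT (rowop f))).
by rewrite expr2 ler_pM2r.
Qed.

Lemma defect_ip_semi : semi_ip defect_ip.
Proof.
have hrow := row_ip_semi; split=> [a f g h|f g|f].
- by rewrite /defect_ip (sip_lin hrow) rowop_linear (sip_lin hF); ring.
- by rewrite /defect_ip rmorphB /= -(sip_sym hrow) -(sip_sym hF).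
- by rewrite subr_ge0 rowop_contraction.
Qed.

Variables (I : finType) (S S' : I -> H -> H) (c c' : I -> L -> I -> L -> C).
Hypotheses (linS : forall r, linear (S r)) (linS' : forall r, linear (S' r)).
Hypothesis adjS : forall r x y, F (S r x) y = F x (S' r y).
Hypothesis conS : forall x, \sum_r F (S' r x) (S' r x) <= F x x.
Hypothesis cc' : forall r l p l', c r l p l' = (c' r l' p l)^*.
Hypothesis unit_c : forall l p l2 p2,
  \sum_r \sum_l' c' r l p l' * (c' r l2 p2 l')^* = ((l == l2) && (p == p2))%:R.
Hypothesis rowS : forall r f, rowop (lift1 c S r f) = S r (rowop f).
Hypothesis rowS' : forall r f, rowop (lift1 c' S' r f) = S' r (rowop f).

(** The row form moves over by [lift1_adjoint]; the subtracted term does because [T~] intertwines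
    the lifts of [S] and [S'] with [S] and [S'] themselves. *)
Lemma defect_adjoint r f g :
  defect_ip (lift1 c S r f) g = defect_ip f (lift1 c' S' r g).
Proof.
by rewrite /defect_ip /row_ip (lift1_adjoint hF _ _ _ adjS cc') rowS rowS' adjS.
Qed.

(** Let [B] be the sum over [r] of the lifted [S_r S_r^*]. It is symmetric for both forms and
    contractive for the row form, so by Reid's inequality it contracts the defect form. The left
    side is [defect_ip (B f) f], and a last use of Cauchy-Schwarz bounds it. *)
Lemma defect_contraction (arch : archimedean_axiom C) f :
  \sum_r defect_ip (lift1 c' S' r f) (lift1 c' S' r f) <= defect_ip f f.
Proof.
pose B f := \sum_r lift1 c S r (lift1 c' S' r f).
have linB : linear B.
  apply: linear_sum_fun => r a x y.
  by rewrite (lift1_linear _ _ linS') (lift1_linear _ _ linS).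
have hrow := row_ip_semi; have hdef := defect_ip_semi.
have rowadj r x y : row_ip (lift1 c S r x) y = row_ip x (lift1 c' S' r y).
  exact: lift1_adjoint.
have BE (G : (L -> H) -> (L -> H) -> C) : semi_ip G ->
    (forall r x y, G (lift1 c S r x) y = G x (lift1 c' S' r y)) ->
    forall x y, G (B x) y = \sum_r G (lift1 c' S' r x) (lift1 c' S' r y).
  by move=> hG adjG x y; rewrite (sip_suml hG); apply: eq_bigr => r _.
have Bsym (G : (L -> H) -> (L -> H) -> C) : semi_ip G ->
    (forall r x y, G (lift1 c S r x) y = G x (lift1 c' S' r y)) ->
    forall x y, G (B x) y = G x (B y).
  move=> hG adjG x y; rewrite (sip_sym hG (B y)) !(BE G hG adjG) rmorph_sum.
  by apply: eq_bigr => r _; exact: sip_sym.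
have Bcon : forall x, row_ip (B x) (B x) <= row_ip x x.
  apply: contraction_of_le => //; first exact: Bsym.
    by move=> x; rewrite BE //; apply: sumr_ge0 => r _; exact: sip_ge0.
  by move=> x; rewrite BE //; exact: lift1_contraction.
have defle x : defect_ip x x <= row_ip x x.
  by rewrite lerBlDr lerDl sip_ge0.
have := reid arch hdef (Bsym _ hdef defect_adjoint) Bcon defle f.
rewrite -(BE _ hdef defect_adjoint) => Bdef.
have Bpos : 0 <= defect_ip (B f) f.
  by rewrite BE //; [apply: sumr_ge0 => r _; exact: sip_ge0 | exact: defect_adjoint].
rewrite -ler_sqr ?nnegrE ?(sip_ge0 hdef) // -[X in X ^+ 2 <= _](ger0_norm Bpos).
rewrite (le_trans (cauchy_schwarz hdef _ _)) // expr2.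
by rewrite ler_wpM2r // (sip_ge0 hdef).
Qed.

End Row.

(** * The Fock-type module of one dilation step *)

Section Fock.
Variables (C : numClosedFieldType) (H : lmodType C) (F : H -> H -> C).
Variables (L : finType) (T T' : L -> H -> H).
Local Notation W := (seq L -> H).

(* The form on the components indexed by words of length [m.+1]. *)
Fixpoint level_ip (m : nat) (x y : W) : C :=
  if m is m'.+1 then \sum_l level_ip m' (branch x l) (branch y l)
  else defect_ip F T (fun l => x [:: l]) (fun l => y [:: l]).

(** Level [m] concerns words of length [m.+1], so this form sees words of length at most [N].
    Truncation gives a form on all functions; by [trunc_ip_stable] it stops depending on [N] once
    one argument is finitely supported. *)
Definition trunc_ip (N : nat) (x y : W) : C :=
  F (x [::]) (y [::]) + \sum_(m < N) level_ip m x y.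

Definition create (l : L) (x : W) : W :=
  fun w => if w is l' :: w' then x w' *+ (l' == l) else T l (x [::]).

(** The value at the empty word is dictated by adjointness: with [z] the one-letter part of [x], the
    defect form of [e_l (x) h] and [z] equals [F h (z_l - T'_l (T~ z))], and [T'_l (x [::])] is the
    adjoint of the [H] component of [create]. *)
Definition annihilate (l : L) (x : W) : W :=
  fun w => if w is _ :: _ then x (l :: w) else
    T' l (x [::]) + x [:: l] - T' l (rowop T (fun l' => x [:: l'])).

Definition vacuum (h : H) : W := fun w => if w is _ :: _ then 0 else h.

Lemma level_ip_local m x x' y y' :
    (forall w, size w = m.+1 -> x w = x' w) ->
    (forall w, size w = m.+1 -> y w = y' w) ->
  level_ip m x y = level_ip m x' y'.
Proof.
elim: m x x' y y' => [|m IH] x x' y y' xx yy /=.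
  by congr (defect_ip _ _ _ _); apply/funext => l; [exact: xx | exact: yy].
by apply: eq_bigr => l _; apply: IH => w sw; [apply: xx | apply: yy]; rewrite /= sw.
Qed.

Hypotheses (hF : semi_ip F).
Hypotheses (linT : forall l, linear (T l)) (linT' : forall l, linear (T' l)).
Hypothesis adjT : forall l x y, F (T l x) y = F x (T' l y).
Hypothesis conT : forall x, \sum_l F (T' l x) (T' l x) <= F x x.

Let hdef : semi_ip (defect_ip F T) := defect_ip_semi hF linT adjT conT.

Lemma level_ip_semi m : semi_ip (level_ip m).
Proof.
elim: m => [|m IH].
  split=> [a x y z|x y|x]; [exact: (sip_lin hdef)|exact: (sip_sym hdef)|].
  exact: (sip_ge0 hdef).
exact: (@semi_ip_sum _ W W L (level_ip m) (fun l x => branch x l)).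
Qed.

Lemma level_ip_eq0 m x y : (forall w, size w = m.+1 -> x w = 0) ->
  level_ip m x y = 0.
Proof.
move=> x0; rewrite (@level_ip_local _ x 0 y y) //.
exact: (sip0l (level_ip_semi m)).
Qed.

Lemma trunc_ip_semi N : semi_ip (trunc_ip N).
Proof.
split=> [a x y z|x y|x].
- rewrite /trunc_ip (sip_lin hF) mulrDr mulr_sumr addrACA -big_split /=.
  by congr (_ + _); apply: eq_bigr => m _; rewrite (sip_lin (level_ip_semi m)).
- rewrite /trunc_ip rmorphD /= -(sip_sym hF) rmorph_sum /=; congr (_ + _).
  by apply: eq_bigr => m _; exact: (sip_sym (level_ip_semi m)).
- by rewrite addr_ge0 ?(sip_ge0 hF) ?sumr_ge0 // => m _; exact: (sip_ge0 (level_ip_semi m)).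
Qed.

Lemma trunc_ip_stable N N' x y : (N <= N')%N ->
  (forall w, (N <= size w)%N -> x w = 0) -> trunc_ip N' x y = trunc_ip N x y.
Proof.
move=> leN x0; rewrite /trunc_ip; congr (_ + _).
rewrite -!(big_mkord xpredT (fun m => level_ip m x y)) (big_cat_nat (leq0n N) leN) /=.
rewrite -[RHS]addr0; congr (_ + _); rewrite big_nat big1 // => m /andP[Nm _].
by apply: level_ip_eq0 => w sw; rewrite x0 // sw ltnW.
Qed.

Lemma create_linear l : linear (create l).
Proof.
move=> a x y; apply/funext => -[|l' w]; first exact: linT.
by rewrite !fctE /= mulrnDl scalerMnr.
Qed.

Lemma annihilate_linear l : linear (annihilate l).
Proof.
move=> a x y; apply/funext => -[|l' w] //=.
have row := rowop_linear linT a (fun l' => x [:: l']) (fun l' => y [:: l']).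
change (T' l (a *: x [::] + y [::]) + (a *: x [:: l] + y [:: l])
  - T' l (rowop T (a *: (fun l' => x [:: l']) + (fun l' => y [:: l'])))
  = a *: annihilate l x [::] + annihilate l y [::]).
rewrite row !linT' !scalerDr scalerN opprD [X in X + _]addrACA.
by rewrite [LHS]addrACA.
Qed.

Lemma branch_create l l' x : branch (create l x) l' = x *+ (l' == l).
Proof. by apply/funext => w; rewrite /branch /=; case: (l' == l). Qed.

(** Creation lengthens words by one, whence the shift of [N]. The [H] component and level 0 on the
    left together produce the three terms of [annihilate] at the empty word; each level [m.+1]
    reduces to level [m]. *)
Lemma trunc_ip_create N l x y :
  trunc_ip N.+1 (create l x) y = trunc_ip N x (annihilate l y).
Proof.
rewrite /trunc_ip big_ord_recl /= addrA; congr (_ + _).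
  rewrite /defect_ip /row_ip.
  have -> : \sum_l0 F (x [::] *+ (l0 == l)) (y [:: l0]) = F (x [::]) (y [:: l]).
    rewrite -(sum_delta l (fun l0 => F (x [::]) (y [:: l0]))).
    by apply: eq_bigr => l0 _; case: (l0 == l); rewrite ?mulr1n // mulr0n (sip0l hF).
  have -> : rowop T (fun l0 => x [::] *+ (l0 == l)) = T l (x [::]).
    rewrite /rowop -(sum_delta l (fun l0 => T l0 (x [::]))).
    by apply: eq_bigr => l0 _; case: (l0 == l); rewrite ?mulr1n // mulr0n (lin0 (linT l0)).
  by rewrite !adjT (sipBr hF) (sipDr hF) addrA.
apply: eq_bigr => m _ /=.
rewrite (@level_ip_local m x x (annihilate l y) (branch y l)) //; last by case.
rewrite -(sum_delta l (fun l0 => level_ip m x (branch y l0))).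
apply: eq_bigr => l0 _; rewrite branch_create.
by case: (l0 == l); rewrite ?mulr1n // mulr0n (sip0l (level_ip_semi m)).
Qed.

(** At the empty word the term [T'_l T_l' (x [::])] occurs twice with opposite signs, once from the
    [H] component and once from the defect correction. This cancellation makes the dilated operators
    isometries with orthogonal ranges. *)
Lemma annihilate_create l l' x : annihilate l (create l' x) = x *+ (l == l').
Proof.
apply/funext => -[|l0 w]; last by rewrite /=; case: (l == l').
rewrite /annihilate /=.
have -> : rowop T (fun l0 => x [::] *+ (l0 == l')) = T l' (x [::]).
  rewrite /rowop -(sum_delta l' (fun l0 => T l0 (x [::]))).
  by apply: eq_bigr => l0 _; case: (l0 == l'); rewrite ?mulr1n // mulr0n (lin0 (linT l0)).
by rewrite addrAC subrr add0r; case: (l == l').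
Qed.

Section Amplified.
Variables (I : finType) (S S' : I -> H -> H) (c c' : I -> L -> I -> L -> C).
Hypotheses (linS : forall r, linear (S r)) (linS' : forall r, linear (S' r)).
Hypothesis adjS : forall r x y, F (S r x) y = F x (S' r y).
Hypothesis conS : forall x, \sum_r F (S' r x) (S' r x) <= F x x.
Hypothesis cc' : forall r l p l', c r l p l' = (c' r l' p l)^*.
Hypothesis unit_c : forall l p l2 p2,
  \sum_r \sum_l' c' r l p l' * (c' r l2 p2 l')^* = ((l == l2) && (p == p2))%:R.
Hypothesis rowS : forall r f, rowop T (lift1 c S r f) = S r (rowop T f).
Hypothesis rowS' : forall r f, rowop T (lift1 c' S' r f) = S' r (rowop T f).

Lemma branch_amp_lift1 (c0 : I -> L -> I -> L -> C) (S0 : I -> H -> H) r x :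
  branch (amp c0 S0 r x) = lift1 c0 (amp c0 S0) r (branch x).
Proof. by apply/funext => l'; exact: branch_amp. Qed.

Lemma level_ip_amp m r x y :
  level_ip m (amp c S r x) y = level_ip m x (amp c' S' r y).
Proof.
elim: m r x y => [|m IH] r x y /=.
  exact: (defect_adjoint hF adjS cc' rowS rowS').
rewrite !branch_amp_lift1.
exact: (lift1_adjoint (level_ip_semi m) _ _ _ IH cc').
Qed.

Lemma trunc_ip_amp N r x y :
  trunc_ip N (amp c S r x) y = trunc_ip N x (amp c' S' r y).
Proof.
by rewrite /trunc_ip /= adjS; congr (_ + _); apply: eq_bigr => m _; exact: level_ip_amp.
Qed.

(** The [H] component is [conS]. Level 0 carries the defect form and uses Reid's inequality; every
    further letter preserves the bound by unitarity of the coefficients. *)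
Lemma trunc_ip_amp_contraction (arch : archimedean_axiom C) N x :
  \sum_r trunc_ip N (amp c' S' r x) (amp c' S' r x) <= trunc_ip N x x.
Proof.
rewrite /trunc_ip big_split /= lerD //.
rewrite exchange_big /=; apply: ler_sum => m _.
elim: {m}(m : nat) x => [|m IH] x /=.
  exact: (defect_contraction hF linT adjT conT linS linS' adjS conS cc' unit_c rowS rowS' arch).
under eq_bigr do rewrite branch_amp_lift1.
exact: (lift1_contraction (level_ip_semi m) _ IH).
Qed.

Lemma amp_create_cons (c0 : I -> L -> I -> L -> C) (S0 : I -> H -> H) q l x l' w :
  (forall r, linear (S0 r)) ->
  amp c0 S0 q (create l x) (l' :: w) = \sum_p c0 q l p l' *: amp c0 S0 p x w.
Proof.
move=> linS0 /=; apply: eq_bigr => p _.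
rewrite -(sum_delta l (fun m => c0 q m p l' *: amp c0 S0 p x w)).
apply: eq_bigr => m _; rewrite branch_create.
case: (m == l); first by rewrite !mulr1n.
by rewrite !mulr0n (lin0 (amp_linear_at c0 linS0 w p)) scaler0.
Qed.

Lemma amp_create (c0 : I -> L -> I -> L -> C) (S0 : I -> H -> H) q l x :
  (forall r, linear (S0 r)) ->
  (forall q l x, S0 q (T l x) = \sum_p \sum_l' c0 q l p l' *: T l' (S0 p x)) ->
  amp c0 S0 q (create l x) = \sum_p \sum_l' c0 q l p l' *: create l' (amp c0 S0 p x).
Proof.
move=> linS0 hS; apply/funext => w; rewrite fct_sumE.
under [RHS]eq_bigr do rewrite fct_sumE.
change (amp c0 S0 q (create l x) w
  = \sum_p \sum_l' c0 q l p l' *: create l' (amp c0 S0 p x) w).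
case: w => [|l' w]; first exact: hS.
rewrite amp_create_cons //; apply: eq_bigr => p _ /=.
rewrite -(sum_delta l' (fun m => c0 q l p m *: amp c0 S0 p x w)).
by apply: eq_bigr => m _; rewrite eq_sym scalerMnr.
Qed.

(** Here the dilated index stands on the left. On the right side, pushing [amp] through the newly
    created letter produces coefficients [c], and [k] inverts them, so only one term survives. *)
Lemma create_amp (k : L -> I -> L -> I -> C) l r x :
  (forall l r x, T l (S r x) = \sum_p \sum_s k l r p s *: S s (T p x)) ->
  (forall l r l' s, \sum_p \sum_t k l r p t * c t p s l'
     = ((l == l') && (r == s))%:R) ->
  create l (amp c S r x) = \sum_p \sum_s k l r p s *: amp c S s (create p x).
Proof.
move=> hS hk; apply/funext => w; rewrite fct_sumE.
under [RHS]eq_bigr do rewrite fct_sumE.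
change (create l (amp c S r x) w
  = \sum_p \sum_s k l r p s *: amp c S s (create p x) w).
case: w => [|l' w]; first exact: hS.
under [RHS]eq_bigr do under eq_bigr do rewrite amp_create_cons // scaler_sumr.
under [RHS]eq_bigr do rewrite exchange_big /=.
rewrite [RHS]exchange_big /= -(sum_delta r (fun t => amp c S t x w)) -sumrMnl.
apply: eq_bigr => t _.
under [RHS]eq_bigr do under eq_bigr do rewrite scalerA.
under [RHS]eq_bigr do rewrite -scaler_suml.
rewrite -scaler_suml hk scaler_nat -mulrnA mulnb [l == l']eq_sym [r == t]eq_sym.
by rewrite andbC.
Qed.

Lemma annihilate_amp q r x :
  (forall q r x, T' r (S q x) = \sum_p \sum_l c q l p r *: S p (T' l x)) ->
  annihilate r (amp c S q x)
    = \sum_p \sum_l c q l p r *: amp c S p (annihilate l x).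
Proof.
move=> hS; apply/funext => w; rewrite fct_sumE.
under [RHS]eq_bigr do rewrite fct_sumE.
change (annihilate r (amp c S q x) w
  = \sum_p \sum_l c q l p r *: amp c S p (annihilate l x) w).
case: w => [|l' w].
  have row : rowop T (fun l' => amp c S q x [:: l'])
    = S q (rowop T (fun l => x [:: l])) := rowS q _.
  rewrite /annihilate row /= !hS.
  rewrite -big_split -sumrB; apply: eq_bigr => p _ /=.
  rewrite -big_split -sumrB; apply: eq_bigr => l _ /=.
  by rewrite (linB (linS p)) (linD (linS p)) scalerBr scalerDr.
apply: eq_bigr => p _; apply: eq_bigr => l _; congr (_ *: _).
Qed.

Lemma amp_vacuum (c0 : I -> L -> I -> L -> C) (S0 : I -> H -> H) q h :
  (forall r, linear (S0 r)) -> amp c0 S0 q (vacuum h) = vacuum (S0 q h).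
Proof.
move=> linS0; apply/funext => -[|l w] //.
by apply: amp_eq0 => // -[].
Qed.

End Amplified.

Lemma annihilate_vacuum l h : annihilate l (vacuum h) = vacuum (T' l h).
Proof.
apply/funext => -[|l' w] //=.
rewrite (_ : rowop T _ = 0) ?(lin0 (linT' l)) ?subr0 ?addr0 //.
exact: (lin0 (rowop_linear linT)).
Qed.

Lemma trunc_ip_vacuum N h y : trunc_ip N (vacuum h) y = F h (y [::]).
Proof.
rewrite /trunc_ip big1 ?addr0 // => m _.
by apply: level_ip_eq0 => -[].
Qed.

(** [create l] also deposits [T l (x [:: l])] at the empty word; the vacuum term corrects for the
    sum of these deposits. This is what yields spanning, hence minimality. *)
Lemma create_decomposition x :
  x = \sum_l create l (branch x l)
      + vacuum (x [::] - rowop T (fun l => x [:: l])).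
Proof.
apply/funext => w; rewrite !fctE fct_sumE.
case: w => [|l' w] /=; first by rewrite addrC subrK.
rewrite addr0 -[LHS](sum_delta l' (fun l => x (l :: w))).
by apply: eq_bigr => l _; rewrite eq_sym.
Qed.

End Fock.

(** * The module of finitely supported functions on words *)

Section FockSpace.
Variables (C : numClosedFieldType) (H : lmodType C) (L : finType).
Local Notation W := (seq L -> H).

Definition supported (N : nat) (x : W) := forall w, (N <= size w)%N -> x w = 0.

Definition finite_support : pred W := fun x => `[< exists N, supported N x >].

Lemma finite_support_submod : submod_closed finite_support.
Proof.
split; first by apply/asboolP; exists 0%N.
move=> a x y /asboolP[N xN] /asboolP[N' yN]; apply/asboolP; exists (maxn N N').
move=> w; rewrite geq_max => /andP[Nw N'w].
by rewrite !fctE /= xN // yN // scaler0 addr0.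
Qed.

HB.instance Definition _ :=
  GRing.isSubmodClosed.Build C W finite_support finite_support_submod.

Record fock := Fock { fock_val :> W; _ : fock_val \in finite_support }.

HB.instance Definition _ := [isSub for fock_val].
HB.instance Definition _ := [Choice of fock by <:].
HB.instance Definition _ := [SubChoice_isSubLmodule of fock by <:].

Lemma fock_supported (x : fock) : exists N, supported N x.
Proof. by case: x => x /= /asboolP. Qed.

Lemma fock_eq (x y : fock) : (x : W) = y -> x = y.
Proof. exact: val_inj. Qed.

Lemma fock_valP a (x y : fock) : (a *: x + y : fock) = a *: (x : W) + (y : W) :> W.
Proof. by []. Qed.

Lemma fock_sumE (I : finType) (f : I -> fock) : (\sum_i f i : fock) = \sum_i (f i : W) :> W.
Proof. exact: (linear_sum (val : {linear fock -> W})). Qed.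

End FockSpace.

(** * Dilating one index *)

Lemma rowop_lift1 (C : numClosedFieldType) (H : lmodType C) (L I : finType)
    (T : L -> H -> H) (S : I -> H -> H) (c : I -> L -> I -> L -> C) r f :
  (forall l, linear (T l)) -> (forall r, linear (S r)) ->
  (forall q l x, S q (T l x) = \sum_p \sum_l' c q l p l' *: T l' (S p x)) ->
  rowop T (lift1 c S r f) = S r (rowop T f).
Proof.
move=> linT linS hS; rewrite (lin_sum (linS r)).
transitivity (\sum_l' \sum_p \sum_l c r l p l' *: T l' (S p (f l))).
  apply: eq_bigr => l' _; rewrite (lin_sum (linT l')); apply: eq_bigr => p _.
  rewrite (lin_sum (linT l')); apply: eq_bigr => l _.
  by rewrite (linZ (linT l')).
under eq_bigr do rewrite exchange_big /=.
rewrite exchange_big /=; apply: eq_bigr => l _.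
by rewrite exchange_big hS.
Qed.

(** Bessel's inequality: [y] satisfies [V' l y = V' l x], so it behaves as the projection of [x] on
    the ranges, and [G (y - x) (y - x) >= 0] becomes [G y y <= G x x]. *)
Lemma isometries_contraction (C : numClosedFieldType) (M : lmodType C)
    (G : M -> M -> C) (L : finType) (V V' : L -> M -> M) :
  semi_ip G -> (forall l, linear (V' l)) ->
  (forall l x y, G (V l x) y = G x (V' l y)) ->
  (forall q r x, V' q (V r x) = x *+ (q == r)) ->
  forall x, \sum_l G (V' l x) (V' l x) <= G x x.
Proof.
move=> hG linV' adjV iso x.
pose y := \sum_l V l (V' l x).
have Gxy : G y x = \sum_l G (V' l x) (V' l x).
  by rewrite (sip_suml hG); apply: eq_bigr => l _; rewrite adjV.
have V'y l : V' l y = V' l x.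
  rewrite (lin_sum (linV' l)) -[RHS](sum_delta l (fun m => V' m x)).
  by apply: eq_bigr => m _; rewrite iso eq_sym.
have Gyy : G y y = G y x.
  rewrite Gxy [in LHS](sip_suml hG); apply: eq_bigr => l _.
  by rewrite adjV V'y.
have Gyy_real : (G y y)^* = G y y by rewrite -(sip_sym hG).
have := sip_ge0 hG (y - x).
rewrite (sip_normB hG) -Gyy Gyy_real -Gxy -Gyy.
have -> : G y y + G x x - (G y y + G y y) = G x x - G y y by ring.
by rewrite subr_ge0.
Qed.

Section System.
Variables (C : numClosedFieldType) (k : nat) (d : 'I_k -> nat).
Variable u : forall i j : 'I_k, 'I_(d i) * 'I_(d j) -> 'I_(d i) * 'I_(d j) -> C.

(** The data that one dilation step reproduces. With a degenerate form, linearity does not follow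
    from having an adjoint, so it is recorded for both families. *)
Record dc_system (M : lmodType C) (G : M -> M -> C)
    (V V' : forall i : 'I_k, 'I_(d i) -> M -> M) : Prop := DcSystem {
  dc_ip : semi_ip G;
  dc_lin : forall i q, linear (V i q);
  dc_lin' : forall i q, linear (V' i q);
  dc_adj : forall i q x y, G (V i q x) y = G x (V' i q y);
  dc_con : forall i x, \sum_q G (V' i q x) (V' i q x) <= G x x;
  dc_comm : forall i j, i != j -> forall q r x,
    V i q (V j r x) = \sum_p \sum_l @u i j (q, r) (p, l) *: V j l (V i p x);
  dc_comm' : forall i j, i != j -> forall q r x,
    V' j r (V i q x) = \sum_p \sum_l @u i j (q, l) (p, r) *: V i p (V' j l x) }.

(** An operator identity instead of a norm identity: it includes the orthogonality of the ranges,
    and it passes through the words by [amp_isometry]. *)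
Definition isometric (M : lmodType C) (V V' : forall i : 'I_k, 'I_(d i) -> M -> M)
    (i : 'I_k) : Prop :=
  forall q r x, V' i q (V i r x) = x *+ (q == r).

(** An algebraic span, without closure; minimality after completion combines it with density. *)
Definition spanned (H M : lmodType C) (J : H -> M)
    (V : forall i : 'I_k, 'I_(d i) -> M -> M) (P : pred 'I_k) : Prop :=
  forall S : M -> Prop,
    (forall a x y, S x -> S y -> S (a *: x + y)) -> (forall h, S (J h)) ->
    (forall i, P i -> forall q x, S x -> S (V i q x)) -> forall x, S x.

Hypothesis arch : archimedean_axiom C.
Hypothesis u_conj : forall i j r l p l',
  @u j i (r, l) (p, l') = (@u i j (l', p) (l, r))^*.
Hypothesis u_rows : forall i j (a a' : 'I_(d i) * 'I_(d j)),
  \sum_b u a b * (u a' b)^* = (a == a')%:R.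
Hypothesis u_braid : forall A B D a b e a2 b2 e2,
  \sum_a1 \sum_b1 \sum_e1
    @u B D (b, e) (b1, e1) * @u A D (a, e1) (a1, e2)
    * @u A B (a1, b1) (a2, b2)
  = \sum_a1 \sum_b1 \sum_e1
    @u A B (a, b) (a1, b1) * @u A D (a1, e) (a2, e1)
    * @u B D (b1, e1) (b2, e2).

Lemma u_inverse i j (q q' : 'I_(d i)) (r r' : 'I_(d j)) :
  \sum_p \sum_l @u i j (q, r) (p, l) * @u j i (l, p) (r', q')
    = ((q == q') && (r == r'))%:R.
Proof.
under eq_bigr do under eq_bigr do rewrite [@u j i _ _]u_conj.
by rewrite pair_bigA /= -[RHS](u_rows (q, r) (q', r')); apply: eq_bigr => -[].
Qed.

Section Step.
Variables (H : lmodType C) (F : H -> H -> C).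
Variables (T T' : forall i : 'I_k, 'I_(d i) -> H -> H).
Hypothesis sysT : dc_system F T T'.
Variable i : 'I_k.

Local Notation L := 'I_(d i).
Local Notation W := (seq L -> H).

Let hF := dc_ip sysT.
Let linT := dc_lin sysT.
Let linT' := dc_lin' sysT.
Let adjT := dc_adj sysT.
Let conT := dc_con sysT.

(* Read off from [S_r V_l = sum u^(j,i)_((r,l),(p,l')) V_l' S_p] and
   [S_r^* V_l = sum u^(i,j)_((l,p),(l',r)) V_l' S_p^*]. *)
Definition coef j (r : 'I_(d j)) (l : L) (p : 'I_(d j)) (l' : L) : C :=
  @u j i (r, l) (p, l').
Definition coef' j (r : 'I_(d j)) (l : L) (p : 'I_(d j)) (l' : L) : C :=
  @u i j (l, p) (l', r).

(** The case distinction keeps the proof of [j = i], which transports the letter [q] to ['I_(d i)].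
    At [j = i] uniqueness of equality proofs removes the cast. *)
Definition step_op j : 'I_(d j) -> W -> W :=
  match j =P i with
  | ReflectT e => fun q => create (@T i) (ecast m 'I_(d m) e q)
  | ReflectF _ => amp (@coef j) (@T j)
  end.

Definition step_op' j : 'I_(d j) -> W -> W :=
  match j =P i with
  | ReflectT e => fun q => annihilate (@T i) (@T' i) (ecast m 'I_(d m) e q)
  | ReflectF _ => amp (@coef' j) (@T' j)
  end.

Lemma step_op_same : @step_op i = create (@T i).
Proof. by rewrite /step_op; case: eqP => // e; rewrite (eq_axiomK e). Qed.

Lemma step_op'_same : @step_op' i = annihilate (@T i) (@T' i).
Proof. by rewrite /step_op'; case: eqP => // e; rewrite (eq_axiomK e). Qed.

Lemma step_op_neq j : j != i -> @step_op j = amp (@coef j) (@T j).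
Proof. by rewrite /step_op; case: eqP. Qed.

Lemma step_op'_neq j : j != i -> @step_op' j = amp (@coef' j) (@T' j).
Proof. by rewrite /step_op'; case: eqP. Qed.

Lemma step_op_linear j q : linear (@step_op j q).
Proof.
case: (eqVneq j i) => [e|ne]; first by subst j; rewrite step_op_same; exact: create_linear.
by rewrite step_op_neq //; exact: amp_linear.
Qed.

Lemma step_op'_linear j q : linear (@step_op' j q).
Proof.
case: (eqVneq j i) => [e|ne].
  by subst j; rewrite step_op'_same; exact: annihilate_linear.
by rewrite step_op'_neq //; exact: amp_linear.
Qed.

Lemma step_op_supported j q N x : supported N x -> supported N.+1 (@step_op j q x).
Proof.
move=> xN; case: (eqVneq j i) => [e|ne].
  by subst j; rewrite step_op_same => -[|l w] // lw; rewrite /= xN // mul0rn.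
rewrite step_op_neq // => w Nw; apply: amp_eq0 => // v sv.
by rewrite xN // sv ltnW.
Qed.

Lemma step_op'_supported j q N x : supported N x -> supported N.+1 (@step_op' j q x).
Proof.
move=> xN; case: (eqVneq j i) => [e|ne].
  by subst j; rewrite step_op'_same => -[|l w] // lw; rewrite /= xN //= ltnW // ltnW.
rewrite step_op'_neq // => w Nw; apply: amp_eq0 => // v sv.
by rewrite xN // sv ltnW.
Qed.

Lemma step_op_finite j q (x : fock H L) : @step_op j q x \in @finite_support _ H L.
Proof.
have [N xN] := fock_supported x; apply/asboolP; exists N.+1.
exact: step_op_supported.
Qed.

Lemma step_op'_finite j q (x : fock H L) : @step_op' j q x \in @finite_support _ H L.
Proof.
have [N xN] := fock_supported x; apply/asboolP; exists N.+1.
exact: step_op'_supported.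
Qed.

Lemma vacuum_finite h : vacuum h \in @finite_support _ H L.
Proof. by apply/asboolP; exists 1%N; case. Qed.

Definition fock_op j (q : 'I_(d j)) (x : fock H L) : fock H L :=
  Fock (step_op_finite q x).
Definition fock_op' j (q : 'I_(d j)) (x : fock H L) : fock H L :=
  Fock (step_op'_finite q x).
Definition fock_vacuum (h : H) : fock H L := Fock (vacuum_finite h).
Definition fock_proj (x : fock H L) : H := fock_val x [::].

(** The truncation is at a chosen bound for the support of [x]; by [fock_ipE] any other bound gives
    the same value. *)
Definition fock_ip (x y : fock H L) : C :=
  trunc_ip F (@T i) (projT1 (cid (fock_supported x))) x y.

Lemma fock_ipE N (x y : fock H L) : supported N x -> fock_ip x y = trunc_ip F (@T i) N x y.
Proof.
rewrite /fock_ip; case: (cid _) => N' /= xN' xN.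
have st := trunc_ip_stable hF (@linT i) (@adjT i) (@conT i).
have [le|/ltnW le] := leqP N N'; first exact: st.
by symmetry; exact: st.
Qed.

Lemma fock_common_support (x y : fock H L) :
  exists N, supported N x /\ supported N y.
Proof.
have [N xN] := fock_supported x; have [N' yN'] := fock_supported y.
exists (maxn N N'); split=> w; rewrite geq_max => /andP[Nw N'w].
  exact: xN.
exact: yN'.
Qed.

Lemma fock_ip_semi : semi_ip fock_ip.
Proof.
have sN N := trunc_ip_semi hF (@linT i) (@adjT i) (@conT i) N.
split=> [a x y z|x y|x].
- have [N [xN yN]] := fock_common_support x y.
  rewrite (fock_ipE _ xN) (fock_ipE _ yN) (@fock_ipE N).
    exact: (sip_lin (sN N)).
  move=> w Nw; transitivity (a *: (x : W) w + (y : W) w) => //.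
  by rewrite xN // yN // scaler0 addr0.
- have [N [xN yN]] := fock_common_support x y.
  by rewrite (fock_ipE _ xN) (fock_ipE _ yN) (sip_sym (sN N)).
- exact: (sip_ge0 (sN _)).
Qed.

Section Neq.
Variable j : 'I_k.
Hypothesis ji : j != i.
Let ij : i != j. Proof. by rewrite eq_sym. Qed.

Lemma neq_comm q l x :
  T q (T l x) = \sum_p \sum_l' @coef j q l p l' *: T l' (T p x).
Proof. exact: (dc_comm sysT). Qed.

Lemma neq_comm' (q : 'I_(d j)) (l : L) x :
  T' q (T l x) = \sum_p \sum_l' @coef' j q l p l' *: T l' (T' p x).
Proof. by rewrite (dc_comm' sysT) // exchange_big. Qed.

Lemma coef_conj r l p l' : @coef j r l p l' = (@coef' j r l' p l)^*.
Proof. exact: u_conj. Qed.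

Lemma coef_unit l p l2 p2 :
  \sum_r \sum_l' @coef' j r l p l' * (@coef' j r l2 p2 l')^*
    = ((l == l2) && (p == p2))%:R.
Proof.
rewrite exchange_big pair_bigA /= -[RHS](u_rows (l, p) (l2, p2)).
by apply: eq_bigr => -[].
Qed.

Lemma neq_row r f : rowop (@T i) (lift1 (@coef j) (@T j) r f) = T r (rowop (@T i) f).
Proof. by apply: rowop_lift1 => //; exact: neq_comm. Qed.

Lemma neq_row' r f :
  rowop (@T i) (lift1 (@coef' j) (@T' j) r f) = T' r (rowop (@T i) f).
Proof. by apply: rowop_lift1 => //; exact: neq_comm'. Qed.

End Neq.

Lemma fock_op_adjoint j q x y : fock_ip (@fock_op j q x) y = fock_ip x (fock_op' q y).
Proof.
have [N xN] := fock_supported x.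
rewrite (@fock_ipE N.+1) /=; last exact: step_op_supported.
rewrite (@fock_ipE N x) //=; case: (eqVneq j i) => [e|ne].
  by subst j; rewrite step_op_same step_op'_same (trunc_ip_create hF (@linT i) (@adjT i) (@conT i)).
rewrite step_op_neq // step_op'_neq //.
rewrite (trunc_ip_amp hF (@linT i) (@adjT i) (@conT i) (@adjT j) (@coef_conj j)).
(* [amp] keeps word lengths, so the form is still truncated at [N.+1]; the support of [x] allows
   lowering this to [N]. *)
- exact: (trunc_ip_stable hF (@linT i) (@adjT i) (@conT i)).
- exact: neq_row.
- exact: neq_row'.
Qed.

Lemma fock_op_isometric_same : isometric fock_op fock_op' i.
Proof.
move=> q r x; apply: fock_eq; rewrite /= step_op_same step_op'_same.
by rewrite annihilate_create //; case: (q == r).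
Qed.

Lemma fock_op_isometric j : j != i -> isometric T T' j -> isometric fock_op fock_op' j.
Proof.
move=> ji iso q r x; apply: fock_eq; rewrite /= step_op_neq // step_op'_neq //.
rewrite amp_isometry //; first by case: (q == r).
move=> q0 r0 l l2; rewrite -mulr_natr -natrM mulnb [q0 == r0]eq_sym.
rewrite -u_inverse; apply: eq_bigr => p _; apply: eq_bigr => l1 _.
exact: mulrC.
Qed.

Lemma fock_op_linear j q : linear (@fock_op j q).
Proof. by move=> a x y; apply: fock_eq; exact: step_op_linear. Qed.

Lemma fock_op'_linear j q : linear (@fock_op' j q).
Proof. by move=> a x y; apply: fock_eq; exact: step_op'_linear. Qed.

Lemma fock_op_contraction j x :
  \sum_q fock_ip (@fock_op' j q x) (fock_op' q x) <= fock_ip x x.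
Proof.
case: (eqVneq j i) => [e|ne].
  subst j; apply: (isometries_contraction fock_ip_semi (@fock_op'_linear i)).
    exact: fock_op_adjoint.
  exact: fock_op_isometric_same.
have [N xN] := fock_supported x.
(* The general support bound for [step_op'] is [N.+1]; both sides must be truncated at the same
   place. *)
have xN1 : supported N.+1 x by move=> w Nw; apply: xN; exact: ltnW.
rewrite (fock_ipE _ xN1).
under eq_bigr => q _.
  rewrite (@fock_ipE N.+1) /=; last exact: step_op'_supported.
  rewrite step_op'_neq //.
  over.
apply: (trunc_ip_amp_contraction hF (@linT i) (@adjT i) (@conT i)
  (@linT j) (@linT' j) (@adjT j) (@conT j) (@coef_conj j)) => //.
- exact: coef_unit.
- exact: neq_row.
- exact: neq_row'.
Qed.

Lemma fock_sum2E (I1 I2 : finType) (a : I1 -> I2 -> C) (f : I1 -> I2 -> fock H L) :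
  (\sum_p \sum_l a p l *: f p l : fock H L)
    = \sum_p \sum_l a p l *: (f p l : W) :> W.
Proof.
rewrite fock_sumE; apply: eq_bigr => p _.
by rewrite fock_sumE.
Qed.

(** The index [i] may equal [j], or [j'], or neither. The first two cases compare [create] with
    [amp]; the third is [amp_comm], whose coefficient condition is the braid identity for [j], [j'],
    [i]. *)
Lemma fock_op_comm j j' : j != j' -> forall q r x,
  fock_op q (fock_op r x)
    = \sum_p \sum_l @u j j' (q, r) (p, l) *: fock_op l (fock_op p x).
Proof.
move=> jj' q r x; apply: fock_eq; rewrite fock_sum2E /=.
case: (eqVneq j i) => [e|ji]; last case: (eqVneq j' i) => [e|j'i].
- subst j; rewrite step_op_same step_op_neq 1?eq_sym //.
  apply: (@create_amp _ _ _ _ _ _ _ _ (fun l r p s => @u i j' (l, r) (p, s))) => //.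
    exact: (dc_comm sysT).
  by move=> *; exact: u_inverse.
- subst j'; rewrite step_op_same step_op_neq //.
  by apply: amp_create => //; exact: neq_comm.
- rewrite !step_op_neq //.
  apply: (@amp_comm _ _ _ _ _ _ _ _ _ _ _ (fun q r p l => @u j j' (q, r) (p, l))) => //.
    exact: (dc_comm sysT).
  move=> q0 r0 l p2 s2 l2.
  transitivity (\sum_a1 \sum_b1 \sum_e1 @u j' i (r0, l) (b1, e1)
      * @u j i (q0, e1) (a1, l2) * @u j j' (a1, b1) (p2, s2)).
    apply: eq_bigr => q1 _; rewrite exchange_big.
    apply: eq_bigr => r1 _; apply: eq_bigr => l1 _.
    by congr (_ * _); exact: mulrC.
  rewrite u_braid; apply: eq_bigr => p _; apply: eq_bigr => s _.
  by apply: eq_bigr => l1 _; exact: mulrAC.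
Qed.

(** The same three cases. If [i = j], the extended adjoints pass a created letter by [amp_create];
    if neither index is [i], the condition is the braid identity for [j], [i], [j'], read from right
    to left. *)
Lemma fock_op_comm' j j' : j != j' -> forall q r x,
  fock_op' r (fock_op q x)
    = \sum_p \sum_l @u j j' (q, l) (p, r) *: fock_op p (fock_op' l x).
Proof.
move=> jj' q r x; apply: fock_eq; rewrite fock_sum2E /=.
case: (eqVneq j i) => [e|ji]; last case: (eqVneq j' i) => [e|j'i].
- subst j; rewrite step_op_same step_op'_neq 1?eq_sym //.
  rewrite exchange_big; apply: amp_create => //; apply: neq_comm'.
  by rewrite eq_sym.
- subst j'; rewrite step_op'_same step_op_neq //.
  apply: annihilate_amp => //; first exact: neq_row.
  exact: (dc_comm' sysT).
- rewrite step_op_neq // step_op'_neq // exchange_big.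
  apply: (@amp_comm _ _ _ _ _ _ _ _ _ _ _ (fun r q l p => @u j j' (q, l) (p, r))) => //.
    by move=> r0 q0 x0; rewrite (dc_comm' sysT) // exchange_big.
  move=> r0 q0 l s2 p2 l2.
  transitivity (\sum_a1 \sum_b1 \sum_e1 @u j i (q0, l) (a1, b1)
      * @u j j' (a1, s2) (p2, e1) * @u i j' (b1, e1) (l2, r0)).
    under eq_bigr do rewrite exchange_big.
    rewrite exchange_big; apply: eq_bigr => q1 _; rewrite exchange_big.
    apply: eq_bigr => l1 _; apply: eq_bigr => r1 _.
    by rewrite -mulrA mulrC.
  rewrite -u_braid [RHS]exchange_big; apply: eq_bigr => p _.
  rewrite [RHS]exchange_big; apply: eq_bigr => l1 _; apply: eq_bigr => s _.
  by rewrite -mulrA mulrC.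
Qed.

Lemma fock_system : dc_system fock_ip fock_op fock_op'.
Proof.
split.
- exact: fock_ip_semi.
- exact: fock_op_linear.
- exact: fock_op'_linear.
- exact: fock_op_adjoint.
- exact: fock_op_contraction.
- exact: fock_op_comm.
- exact: fock_op_comm'.
Qed.

Lemma fock_vacuum_linear : linear fock_vacuum.
Proof.
by move=> a x y; apply: fock_eq; apply/funext => -[|l w] //=; rewrite !fctE /= scaler0 addr0.
Qed.

Lemma fock_vacuum_adjoint h x : fock_ip (fock_vacuum h) x = F h (fock_proj x).
Proof.
rewrite (@fock_ipE 1%N); last by case.
exact: (trunc_ip_vacuum hF (@linT i) (@adjT i) (@conT i)).
Qed.

Lemma fock_op'_vacuum j q h : @fock_op' j q (fock_vacuum h) = fock_vacuum (T' q h).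
Proof.
apply: fock_eq => /=; case: (eqVneq j i) => [e|ji].
  by subst j; rewrite step_op'_same annihilate_vacuum.
by rewrite step_op'_neq // amp_vacuum.
Qed.

Lemma fock_op_vacuum j q h : j != i -> @fock_op j q (fock_vacuum h) = fock_vacuum (T q h).
Proof. by move=> ji; apply: fock_eq; rewrite /= step_op_neq // amp_vacuum. Qed.

(** Induction on a bound for the support: the branches of [x] have a smaller bound, and
    [create_decomposition] rebuilds [x] from them and a vacuum vector. *)
Lemma fock_spanned : spanned fock_vacuum fock_op (pred1 i).
Proof.
move=> S SP SJ SV x.
have S0 : S 0 by rewrite -[0](lin0 fock_vacuum_linear).
have Ssum (I : finType) (f : I -> fock H L) : (forall l, S (f l)) -> S (\sum_l f l).
  move=> Sf; elim/big_rec: _ => // l y _ Sy.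
  by rewrite -[f l]scale1r; exact: SP.
have [N] := fock_supported x; elim: N x => [|N IH] x xN.
  suff -> : x = 0 by [].
  by apply: fock_eq; apply/funext => w; rewrite xN.
have brN l : supported N (branch x l) by move=> w Nw; rewrite /branch xN.
have brf l : branch x l \in @finite_support _ H L by apply/asboolP; exists N.
pose y l : fock H L := Fock (brf l).
have -> : x = 1 *: (\sum_l fock_op l (y l))
    + fock_vacuum (x [::] - rowop (@T i) (fun l => x [:: l])).
  apply: fock_eq; rewrite fock_valP scale1r fock_sumE.
  rewrite {1}[fock_val x](create_decomposition (@T i)); congr (_ + _).
  by apply: eq_bigr => l _ /=; rewrite step_op_same.
apply: SP => //; apply: Ssum => l; apply: SV => /=; first exact: eqxx.
by apply: IH; exact: brN.
Qed.

End Step.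

(* Spanning by the dilated operators only is what propagates: [fock_vacuum]
   intertwines [V j] for [j <> i], but not for the index [i] being dilated. *)
Lemma dilation_stage (H : lmodType C) (F : H -> H -> C)
    (T T' : forall i : 'I_k, 'I_(d i) -> H -> H) :
  dc_system F T T' -> forall m, (m <= k)%N ->
  exists (M : lmodType C) (G : M -> M -> C) (J : H -> M) (J' : M -> H)
    (V V' : forall i : 'I_k, 'I_(d i) -> M -> M),
  [/\ dc_system G V V', linear J,
     (forall h x, G (J h) x = F h (J' x)) /\ (forall h, J' (J h) = h),
     (forall i q h, V' i q (J h) = J (T' i q h)) &
     (forall i : 'I_k, (i < m)%N -> isometric V V' i) /\
     spanned J V (fun i => (i < m)%N)].
Proof.
move=> sysT; elim=> [|m IH] mk.
  exists H, F, id, id, T, T'; split=> //.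
  by split=> // S _ SJ _ x; exact: SJ.
have [M [G [J [J' [V [V' [sysV linJ [adjJ JK] V'J [iso span]]]]]]]] := IH (ltnW mk).
pose i := Ordinal mk.
exists (fock M 'I_(d i)), (fock_ip G V (i := i)), (@fock_vacuum M i \o J),
  (J' \o @fock_proj M i), (fock_op sysV (i := i)), (fock_op' sysV (i := i)).
split.
- exact: fock_system.
- by move=> a x y /=; rewrite linJ fock_vacuum_linear.
- split=> [h x|h] /=; last exact: JK.
  by rewrite (fock_vacuum_adjoint sysV) adjJ.
- by move=> j q h /=; rewrite fock_op'_vacuum V'J.
- split=> [j|S SP SJ SV].
    rewrite ltnS leq_eqVlt => /predU1P[jm|jm].
      suff -> : j = i by exact: fock_op_isometric_same.
      exact: val_inj.
    apply: fock_op_isometric; last exact: iso.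
    by apply: contraTneq jm => ->; rewrite ltnn.
  apply: (fock_spanned (sysT := sysV) SP) => [h|j /eqP -> q x Sx]; last exact: SV.
  (* It remains to reach the vacuum vectors over [M]. On them the operators of index below [m] act
     as they do on [M], so the spanning of [M] pulls back along [fock_vacuum]. *)
  apply: (span (fun y => S (fock_vacuum i y))) h => [a x y Sx Sy|h|j jm q x Sx].
  - by rewrite fock_vacuum_linear; exact: SP.
  - exact: SJ.
  - rewrite -(fock_op_vacuum sysV).
      by apply: SV => //; exact: ltnW.
    by apply: contraTneq jm => ->; rewrite ltnn.
Qed.

End System.

(** * Hausdorff completion *)

Section SemiNorm.
Variables (C : numClosedFieldType) (V : lmodType C) (F : V -> V -> C).
Hypothesis hF : semi_ip F.

Definition semi_norm (x : V) : C := sqrtC (F x x).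
Local Notation nm := semi_norm.

Lemma semi_norm_ge0 x : 0 <= nm x. Proof. by rewrite sqrtC_ge0 sip_ge0. Qed.

Lemma semi_norm_sqr x : nm x ^+ 2 = F x x. Proof. exact: sqrtCK. Qed.

Lemma semi_norm_cs x y : `|F x y| <= nm x * nm y.
Proof. by apply: sip_bound; rewrite ?semi_norm_ge0 ?semi_norm_sqr. Qed.

Lemma semi_normD x y : nm (x + y) <= nm x + nm y.
Proof.
rewrite -ler_sqr ?nnegrE ?addr_ge0 ?semi_norm_ge0 // semi_norm_sqr.
rewrite sqrrD !semi_norm_sqr (sipDl hF) !(sipDr hF) [F y x](sip_sym hF x y).
have -> : F x x + F x y + ((F x y)^* + F y y)
    = F x x + 'Re (F x y) *+ 2 + F y y.
  rewrite -addrA -addrA; congr (_ + _); rewrite addrA; congr (_ + _).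
  by rewrite ReE -mulr_natr divfK // pnatr_eq0.
rewrite lerD2r lerD2l lerMn2r /=.
exact: le_trans (leif_Re_Creal _) (semi_norm_cs x y).
Qed.

Lemma semi_normZ a x : nm (a *: x) = `|a| * nm x.
Proof.
apply/eqP; rewrite -(eqrXn2 (n := 2)) ?mulr_ge0 ?semi_norm_ge0 //.
by rewrite exprMn !semi_norm_sqr (sipZl hF) (sipZr hF) mulrA -normCK.
Qed.

Lemma semi_normN x : nm (- x) = nm x.
Proof. by rewrite -scaleN1r semi_normZ normrN1 mul1r. Qed.

Lemma semi_normC x y : nm (x - y) = nm (y - x).
Proof. by rewrite -opprB semi_normN. Qed.

Lemma semi_norm_tri z x y : nm (x - y) <= nm (x - z) + nm (z - y).
Proof. by rewrite (le_trans _ (semi_normD _ _)) // addrA subrK. Qed.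

Lemma semi_norm_lt x e : 0 < e -> (nm x < e) = (F x x < e ^+ 2).
Proof. by move=> e0; rewrite -ltr_sqr ?nnegrE ?semi_norm_ge0 ?ltW // semi_norm_sqr. Qed.

End SemiNorm.

(** * Completeness of the complex numbers and limits of scalars *)

Section ComplexLimits.
Variable R : realType.
Local Notation C := R[i].
Local Notation toC := (real_complex R).

Lemma complex_archimedean : archimedean_axiom C.
Proof.
move=> x x0; exists (Num.bound (complex.Re x)).
have xr : x \is Num.real by exact: ger0_real.
rewrite -(RRe_real xr) -(rmorph_nat (real_complex R)) ltcR.
by apply: archi_boundP; rewrite -(ler0c) (RRe_real xr).
Qed.

Definition scvg (s : nat -> C) (l : C) :=
  forall e, 0 < e -> exists N, forall n, (N <= n)%N -> `|s n - l| < e.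

Definition scauchy (s : nat -> C) :=
  forall e, 0 < e -> exists N, forall m n, (N <= m)%N -> (N <= n)%N -> `|s m - s n| < e.

(** The limit is the supremum of the eventual lower bounds of the sequence, that is, its lower
    limit. *)
Lemma real_complete (s : nat -> R) :
  (forall e, 0 < e -> exists N, forall m n, (N <= m)%N -> (N <= n)%N -> `|s m - s n| < e) ->
  exists l, forall e, 0 < e -> exists N, forall n, (N <= n)%N -> `|s n - l| < e.
Proof.
move=> cs.
pose A : set R := fun y => exists N, forall n, (N <= n)%N -> y <= s n.
have inA N e : (forall m n, (N <= m)%N -> (N <= n)%N -> `|s m - s n| < e) -> A (s N - e).
  move=> h; exists N => n Nn; have := h N n (leqnn _) Nn; rewrite ltr_norml => /andP[_].
  by lra.
have ubA N e : (forall m n, (N <= m)%N -> (N <= n)%N -> `|s m - s n| < e) -> ubound A (s N + e).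
  move=> h y [N' yN']; have := yN' (maxn N N') (leq_maxr _ _).
  have := h (maxn N N') N (leq_maxl _ _) (leqnn _).
  by rewrite ltr_norml => /andP[_]; lra.
have supA : has_sup A.
  have [N hN] := cs 1 ltr01.
  by split; [exists (s N - 1); exact: inA | exists (s N + 1); exact: ubA].
exists (sup A) => e e0; have e20 : 0 < e / 2 by lra.
have [N hN] := cs _ e20; exists N => n Nn.
have l1 := sup_upper_bound supA (inA _ _ hN).
have l2 : sup A <= s N + e / 2 by apply: ge_sup; [case: supA | exact: ubA].
have := hN n N Nn (leqnn _); rewrite !ltr_norml => /andP[h1 h2].
by apply/andP; split; lra.
Qed.

Lemma complex_complete s : scauchy s -> exists l, scvg s l.
Proof.
move=> cs.
have norm_ge_Im (z : C) : toC `|complex.Im z| <= `|z|.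
  have := normc_ge_Re (z * 'i%C); rewrite ReiNIm normrN normrM.
  by rewrite (_ : `|'i%C| = 1 :> C) ?mulr1 // complexiE normCi.
have part (p : C -> R) : (forall x y, p (x - y) = p x - p y) ->
    (forall z, toC `|p z| <= `|z|) ->
    exists l, forall e : R, 0 < e -> exists N, forall n, (N <= n)%N -> `|p (s n) - l| < e.
  move=> pB ple; apply: real_complete => e e0.
  have [|N hN] := cs (toC e); first by rewrite ltcR.
  exists N => m n Nm Nn; rewrite -pB -ltcR.
  exact: le_lt_trans (ple _) (hN _ _ Nm Nn).
have [a ha] := part (@complex.Re R) (fun x y => raddfB _ _ _) (@normc_ge_Re _).
have [b hb] := part (@complex.Im R) (fun x y => raddfB _ _ _) norm_ge_Im.
exists (a +i* b)%C => e e0.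
have er : e \is Num.real by exact: gtr0_real.
have e20 : 0 < complex.Re e / 2.
  by rewrite divr_gt0 // -ltcR (RRe_real er).
have [N1 h1] := ha _ e20; have [N2 h2] := hb _ e20.
exists (maxn N1 N2) => n; rewrite geq_max => /andP[Nn1 Nn2].
have -> : s n - (a +i* b)%C = toC (complex.Re (s n) - a) + 'i%C * toC (complex.Im (s n) - b).
  by rewrite [LHS]complexE; case: (s n).
apply: le_lt_trans (ler_normD _ _) _.
rewrite normrM (_ : `|'i%C| = 1 :> C) ?mul1r; last by rewrite complexiE normCi.
rewrite -(RRe_real er) (_ : toC (complex.Re e)
  = toC (complex.Re e / 2) + toC (complex.Re e / 2)); last first.
  by rewrite -rmorphD -splitr.
have nr (x : R) : `|toC x| = toC `|x| :> C.
  by rewrite normc_def /= expr0n /= addr0 sqrtr_sqr.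
by rewrite ltrD // nr ltcR ?h1 ?h2.
Qed.

Lemma scvg_unique s l l' : scvg s l -> scvg s l' -> l = l'.
Proof.
move=> sl sl'; apply/eqP; rewrite -subr_eq0; apply: contraT => ne.
have e0 : 0 < `|l - l'| / 2 by rewrite divr_gt0 ?normr_gt0.
have [N h] := sl _ e0; have [N' h'] := sl' _ e0.
have := ltrD (h _ (leq_maxl N N')) (h' _ (leq_maxr N N')).
rewrite -splitr distrC => /(le_lt_trans (ler_normD _ _)).
by rewrite addrA subrK ltxx.
Qed.

Lemma scvg_lin a s t l l' : scvg s l -> scvg t l' ->
  scvg (fun n => a * s n + t n) (a * l + l').
Proof.
move=> sl tl e e0.
(* Adding 1 keeps the divisor positive when [a = 0]. *)
have b0 : 0 < `|a| + 1 by rewrite ltr_pwDr.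
have e20 : 0 < e / 2 by rewrite divr_gt0.
have [N h] := sl _ (divr_gt0 e20 b0); have [N' h'] := tl _ e20.
exists (maxn N N') => n; rewrite geq_max => /andP[Nn N'n].
have -> : a * s n + t n - (a * l + l') = a * (s n - l) + (t n - l') by ring.
apply: le_lt_trans (ler_normD _ _) _; rewrite [X in _ < X]splitr ler_ltD ?h' //.
rewrite normrM (@le_trans _ _ ((`|a| + 1) * `|s n - l|)) //.
  by rewrite ler_wpM2r // lerDl.
by rewrite mulrC -ler_pdivlMr // ltW // h.
Qed.

Lemma scvg_conj s l : scvg s l -> scvg (fun n => (s n)^*) l^*.
Proof.
move=> sl e /sl[N h]; exists N => n /h.
by rewrite -rmorphB norm_conjC.
Qed.

Lemma scvg_norm s l : scvg s l -> scvg (fun n => `|s n|) `|l|.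
Proof.
move=> sl e /sl[N h]; exists N => n /h; apply: le_lt_trans.
exact: ler_dist_dist.
Qed.

Lemma scvg_cst l : scvg (fun _ => l) l.
Proof. by move=> e e0; exists 0%N => n _; rewrite subrr normr0. Qed.

Lemma scvg_ev s t l N : (forall n, (N <= n)%N -> s n = t n) -> scvg s l -> scvg t l.
Proof.
move=> st sl e /sl[N' h]; exists (maxn N N') => n; rewrite geq_max => /andP[Nn N'n].
by rewrite -st // h.
Qed.

(** The sequence eventually coincides with its norms, so uniqueness of limits gives [l = |l|]; in
    particular the limit is real. *)
Lemma scvg_ge0 s l N : (forall n, (N <= n)%N -> 0 <= s n) -> scvg s l -> 0 <= l.
Proof.
move=> s0 sl; have -> : l = `|l| by
  apply: (scvg_unique sl); apply: (scvg_ev (N := N) _ (scvg_norm sl)) => n /s0/ger0_norm.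
exact: normr_ge0.
Qed.

Lemma scvg_le s l b N : (forall n, (N <= n)%N -> s n <= b) -> scvg s l -> l <= b.
Proof.
move=> sb sl; rewrite -subr_ge0.
apply: (@scvg_ge0 (fun n => -1 * s n + b) _ N) => [n /sb|]; first by rewrite mulN1r addrC subr_ge0.
by rewrite -[- l]mulN1r addrC; apply: scvg_lin => //; exact: scvg_cst.
Qed.

End ComplexLimits.

Section SemiNormLimits.
Variables (R : realType) (M : lmodType R[i]) (G : M -> M -> R[i]).
Hypothesis hG : semi_ip G.
Local Notation C := R[i].
Local Notation nm := (semi_norm G).

Lemma converges_toP s l : converges_to G s l <->
  forall e : C, 0 < e -> exists N, forall n, (N <= n)%N -> nm (s n - l) < e.
Proof.
split=> h e e0.
  have [|N hN] := h (e ^+ 2); first by rewrite exprn_gt0.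
  by exists N => n /hN; rewrite semi_norm_lt.
have [|N hN] := h (sqrtC e); first by rewrite sqrtC_gt0.
by exists N => n /hN; rewrite semi_norm_lt ?sqrtC_gt0 // sqrtCK.
Qed.

Lemma cauchy_seqP s : cauchy_seq G s <->
  forall e : C, 0 < e -> exists N, forall m n, (N <= m)%N -> (N <= n)%N ->
    nm (s m - s n) < e.
Proof.
split=> h e e0.
  have [|N hN] := h (e ^+ 2); first by rewrite exprn_gt0.
  by exists N => m n Nm /(hN m n Nm); rewrite semi_norm_lt.
have [|N hN] := h (sqrtC e); first by rewrite sqrtC_gt0.
by exists N => m n Nm /(hN m n Nm); rewrite semi_norm_lt ?sqrtC_gt0 // sqrtCK.
Qed.

Lemma semi_norm_lin a x y e : 0 < e -> nm x < e / 2 / (`|a| + 1) -> nm y < e / 2 ->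
  nm (a *: x + y) < e.
Proof.
move=> e0 xe ye; have b0 : 0 < `|a| + 1 by rewrite ltr_pwDr.
apply: le_lt_trans (semi_normD hG _ _) _; rewrite [X in _ < X]splitr ler_ltD //.
rewrite (semi_normZ hG) (@le_trans _ _ ((`|a| + 1) * nm x)) //.
  by rewrite ler_wpM2r ?semi_norm_ge0 // lerDl.
by rewrite mulrC -ler_pdivlMr // ltW.
Qed.

Lemma semi_norm_lin_gt0 (a e : C) : 0 < e -> 0 < e / 2 / (`|a| + 1) /\ 0 < e / 2.
Proof. by move=> e0; rewrite !divr_gt0 // ltr_pwDr. Qed.

Lemma converges_to_lin a s t l l' : converges_to G s l -> converges_to G t l' ->
  converges_to G (fun n => a *: s n + t n) (a *: l + l').
Proof.
move=> /converges_toP sl /converges_toP tl; apply/converges_toP => e e0.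
have [e1 e2] := semi_norm_lin_gt0 a e0.
have [N h] := sl _ e1; have [N' h'] := tl _ e2.
exists (maxn N N') => n; rewrite geq_max => /andP[/h hn /h' h'n].
by rewrite opprD addrACA -scalerBr; exact: semi_norm_lin.
Qed.

Lemma cauchy_seq_lin a s t : cauchy_seq G s -> cauchy_seq G t ->
  cauchy_seq G (fun n => a *: s n + t n).
Proof.
move=> /cauchy_seqP sl /cauchy_seqP tl; apply/cauchy_seqP => e e0.
have [e1 e2] := semi_norm_lin_gt0 a e0.
have [N h] := sl _ e1; have [N' h'] := tl _ e2.
exists (maxn N N') => m n; rewrite !geq_max => /andP[mN mN'] /andP[nN nN'].
rewrite opprD addrACA -scalerBr; apply: semi_norm_lin => //; first exact: h.
exact: h'.
Qed.

Lemma converges_to_cst x : converges_to G (fun _ => x) x.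
Proof. by move=> e e0; exists 0%N => n _; rewrite /dist2 subrr (sip0l hG). Qed.

Lemma converges_cauchy s l : converges_to G s l -> cauchy_seq G s.
Proof.
move=> /converges_toP sl; apply/cauchy_seqP => e e0.
have e20 : 0 < e / 2 by rewrite divr_gt0.
have [N h] := sl _ e20; exists N => m n mN nN.
apply: le_lt_trans (semi_norm_tri hG l _ _) _; rewrite [X in _ < X]splitr.
by rewrite ltrD ?h // (semi_normC hG) h.
Qed.

Lemma cauchy_bounded s : cauchy_seq G s ->
  exists2 B : C, 0 < B & exists N, forall n, (N <= n)%N -> nm (s n) <= B.
Proof.
move=> /cauchy_seqP/(_ 1 ltr01)[N h].
exists (1 + nm (s N)); first by rewrite ltr_wpDr ?semi_norm_ge0.
exists N => n Nn; rewrite -[s n](subrK (s N)) (le_trans (semi_normD hG _ _)) //.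
by rewrite lerD2r ltW // h.
Qed.

Lemma sip_small x y (B e : C) : 0 < B -> nm x < e / B -> nm y <= B -> `|G x y| < e.
Proof.
move=> B0 xe yB; apply: le_lt_trans (semi_norm_cs hG _ _) _.
apply: (@le_lt_trans _ _ (nm x * B)); first by rewrite ler_wpM2l ?semi_norm_ge0.
by rewrite -ltr_pdivlMr.
Qed.

Lemma sip_cauchy s t : cauchy_seq G s -> cauchy_seq G t ->
  scauchy (fun n => G (s n) (t n)).
Proof.
move=> cs ct e e0.
have [B B0 [N1 hB]] := cauchy_bounded cs; have [B' B'0 [N2 hB']] := cauchy_bounded ct.
have e20 : 0 < e / 2 by rewrite divr_gt0.
have /cauchy_seqP/(_ _ (divr_gt0 e20 B'0))[N3 h3] := cs.
have /cauchy_seqP/(_ _ (divr_gt0 e20 B0))[N4 h4] := ct.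
exists (maxn (maxn N1 N2) (maxn N3 N4)) => m n; rewrite !geq_max.
move=> /andP[/andP[m1 m2] /andP[m3 m4]] /andP[/andP[n1 n2] /andP[n3 n4]].
have -> : G (s m) (t m) - G (s n) (t n)
    = G (s m - s n) (t m) + G (s n) (t m - t n).
  by rewrite (sipBl hG) (sipBr hG); ring.
apply: le_lt_trans (ler_normD _ _) _; rewrite [X in _ < X]splitr ltrD //.
  exact: (sip_small B'0 (h3 _ _ m3 n3) (hB' _ m2)).
rewrite (sip_sym hG (t m - t n)) norm_conjC.
exact: (sip_small B0 (h4 _ _ m4 n4) (hB _ n1)).
Qed.

Lemma sip_cvg_null s t : converges_to G s 0 -> cauchy_seq G t ->
  scvg (fun n => G (s n) (t n)) 0.
Proof.
move=> /converges_toP s0 ct e e0; have [B B0 [N1 hB]] := cauchy_bounded ct.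
have [N h] := s0 _ (divr_gt0 e0 B0).
exists (maxn N N1) => n; rewrite geq_max subr0 => /andP[/h hn /hB Bn].
by rewrite subr0 in hn; exact: sip_small hn Bn.
Qed.

End SemiNormLimits.

(** * Cauchy sequences modulo null sequences *)

Section Completion.
Variables (R : realType) (M : lmodType R[i]) (G : M -> M -> R[i]).
Variable hG : semi_ip G.
Local Notation C := R[i].
Local Notation nm := (semi_norm G).

(* The proof argument lets the canonical submodule structure on this predicate
   depend on the positivity of [G]. *)
Definition cauchyp (_ : semi_ip G) (s : nat -> M) : bool := `[< cauchy_seq G s >].

Lemma cauchyp_submod : submod_closed (cauchyp hG).
Proof.
split; first by apply/asboolP; apply: (@converges_cauchy _ _ _ hG _ 0);
  exact: (converges_to_cst hG 0).
move=> a s t /asboolP cs /asboolP ct; apply/asboolP.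
exact: (cauchy_seq_lin hG a cs ct).
Qed.

HB.instance Definition _ :=
  GRing.isSubmodClosed.Build C (nat -> M) (cauchyp hG) cauchyp_submod.

Record cseq := CSeq { cseq_val :> nat -> M; _ : cseq_val \in cauchyp hG }.

HB.instance Definition _ := [isSub for cseq_val].
HB.instance Definition _ := [Choice of cseq by <:].
HB.instance Definition _ := [SubChoice_isSubLmodule of cseq by <:].

Lemma cseqP (s : cseq) : cauchy_seq G s.
Proof. by case: s => s /= /asboolP. Qed.

Definition nullp (s : cseq) : bool := `[< converges_to G s 0 >].

Lemma nullp_submod : submod_closed nullp.
Proof.
split; first by apply/asboolP; exact: (converges_to_cst hG 0).
move=> a s t /asboolP cs /asboolP ct; apply/asboolP.
by have := converges_to_lin hG a cs ct; rewrite scaler0 addr0.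
Qed.

(** One quotient does two things: constant sequences at vectors of norm zero are null, so it
    separates the semi-inner product while completing. *)
Definition null_ideal : zmodClosed cseq :=
  HB.pack_for (zmodClosed cseq) nullp
    (GRing.isZmodClosed.Build cseq nullp (GRing.submod_closedB nullp_submod)).

Definition completion := Quotient.quot null_ideal.
HB.instance Definition _ := GRing.Zmodule.on completion.

Definition cls (s : cseq) : completion := (\pi_(Quotient.quot null_ideal) s)%qT.
Definition rep (f : completion) : cseq := repr (f : Quotient.quot null_ideal).

Lemma repK f : cls (rep f) = f. Proof. exact: reprK. Qed.

Lemma cls_eqP s t : cls s = cls t <-> converges_to G (s - t : cseq) 0.
Proof.
split.
  move=> /eqP; rewrite /cls -Quotient.idealrBE => /asboolP //.
by move=> h; apply/eqP; rewrite /cls -Quotient.idealrBE; apply/asboolP.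
Qed.

Lemma clsD s t : cls (s + t) = cls s + cls t.
Proof. exact: Quotient.pi_add. Qed.

(** The quotient provides the additive group only. Scalars act through representatives, and
    [cscale_cls] shows that the choice does not matter. *)
Definition cscale (a : C) (f : completion) : completion := cls (a *: rep f).

Lemma cscale_cls a s : cscale a (cls s) = cls (a *: s).
Proof.
apply/cls_eqP; rewrite -scalerBr; have /cls_eqP h := repK (cls s).
have := converges_to_lin hG a h (converges_to_cst hG 0).
rewrite scaler0 addr0 => hh e /hh[N hN]; exists N => n /hN.
by rewrite addr0.
Qed.

Lemma cscaleA a b f : cscale a (cscale b f) = cscale (a * b) f.
Proof. by rewrite -(repK f) !cscale_cls scalerA. Qed.
Lemma cscale1 : left_id 1 cscale.
Proof. by move=> f; rewrite -(repK f) cscale_cls scale1r. Qed.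
Lemma cscaleDr : right_distributive cscale +%R.
Proof.
by move=> a f g; rewrite -(repK f) -(repK g) -clsD !cscale_cls scalerDr clsD.
Qed.
Lemma cscaleDl f : {morph cscale^~ f : a b / a + b}.
Proof. by move=> a b; rewrite -(repK f) !cscale_cls scalerDl clsD. Qed.

HB.instance Definition _ := GRing.Zmodule_isLmodule.Build C completion
  cscaleA cscale1 cscaleDr cscaleDl.

Lemma cls_lin a s t : cls (a *: s + t) = a *: cls s + cls t.
Proof. by rewrite clsD -cscale_cls. Qed.

End Completion.

(** * The inner product on the completion and its completeness *)

Section CompletionHilbert.
Variables (R : realType) (M : lmodType R[i]) (G : M -> M -> R[i]).
Variable hG : semi_ip G.
Local Notation C := R[i].
Local Notation nm := (semi_norm G).
Local Notation K := (completion hG).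

Definition limit_ip (s t : cseq hG) : C :=
  projT1 (cid (complex_complete (sip_cauchy hG (cseqP s) (cseqP t)))).

Lemma limit_ipP (s t : cseq hG) : scvg (fun n => G (s n) (t n)) (limit_ip s t).
Proof. by rewrite /limit_ip; case: (cid _). Qed.

Definition completion_ip (f g : K) : C := limit_ip (rep f) (rep g).

(** Independence of the representatives: changing [s] to [s'] and then [t] to [t'] alters the form
    by pairings of a null sequence with a Cauchy sequence, which tend to 0. *)
Lemma completion_ipP (s t : cseq hG) :
  scvg (fun n => G (s n) (t n)) (completion_ip (cls s) (cls t)).
Proof.
set s' := rep (cls s); set t' := rep (cls t).
have /cls_eqP hs : cls s = cls s' by rewrite repK.
have /cls_eqP ht : cls t = cls t' by rewrite repK.
have e1 := sip_cvg_null hG hs (cseqP t).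
have e2 := scvg_conj (sip_cvg_null hG ht (cseqP s')).
have := scvg_lin 1 e1 (scvg_lin 1 e2 (limit_ipP s' t')).
rewrite rmorph0 mulr0 !add0r; apply: (scvg_ev (N := 0%N)) => n _.
rewrite !mul1r -(sip_sym hG).
change (G (s n - s' n) (t n) + (G (s' n) (t n - t' n) + G (s' n) (t' n)) = G (s n) (t n)).
by rewrite (sipBl hG) (sipBr hG) subrK subrK.
Qed.

Lemma completion_ip_eq (s t : cseq hG) l :
  scvg (fun n => G (s n) (t n)) l -> completion_ip (cls s) (cls t) = l.
Proof. by move=> h; apply: scvg_unique (completion_ipP s t) h. Qed.

Lemma completion_ip_semi : semi_ip completion_ip.
Proof.
split=> [a f g h|f g|f].
- rewrite -(repK f) -(repK g) -(repK h) -cls_lin; apply: completion_ip_eq.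
  have := scvg_lin a (completion_ipP (rep f) (rep h)) (completion_ipP (rep g) (rep h)).
  by apply: (scvg_ev (N := 0%N)) => n _; rewrite -(sip_lin hG).
- rewrite -(repK f) -(repK g); apply: completion_ip_eq.
  have := scvg_conj (completion_ipP (rep f) (rep g)).
  by apply: (scvg_ev (N := 0%N)) => n _; rewrite -(sip_sym hG).
- rewrite -(repK f); apply: (scvg_ge0 (N := 0%N) _ (completion_ipP (rep f) (rep f))) => n _.
  exact: (sip_ge0 hG).
Qed.

Lemma completion_ip_definite f : completion_ip f f = 0 -> f = 0.
Proof.
rewrite -(repK f) => f0; have := completion_ipP (rep f) (rep f); rewrite f0 => h.
have -> : 0 = cls (0 : cseq hG) by rewrite -[RHS](addrK (cls 0)) -clsD addr0 subrr.
apply/cls_eqP; rewrite subr0 => e /h[N hN]; exists N => n /hN.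
by rewrite /dist2 !subr0 ger0_norm // (sip_ge0 hG).
Qed.

Lemma const_cauchy (x : M) : (fun _ : nat => x) \in cauchyp hG.
Proof.
apply/asboolP; apply: (converges_cauchy hG (l := x)); exact: converges_to_cst.
Qed.

Definition embed (x : M) : K := cls (CSeq (const_cauchy x)).

Lemma embed_linear : linear embed.
Proof.
move=> a x y; rewrite /embed -cls_lin; apply/cls_eqP => e e0; exists 0%N => n _.
by rewrite /dist2 subr0 /= (_ : _ - _ = 0) ?(sip0l hG) //; exact: subrr.
Qed.

Lemma embed_ip x y : completion_ip (embed x) (embed y) = G x y.
Proof. by apply: completion_ip_eq; exact: scvg_cst. Qed.

Lemma embed_converges (s : cseq hG) :
  converges_to completion_ip (fun n => embed (s n)) (cls s).
Proof.
(* A strict bound becomes weak in the limit, hence [e / 2] for a conclusion strictly below [e]. *)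
move=> e e0; have [N h] := cseqP s (divr_gt0 e0 (ltr0Sn _ 1)).
exists N => n Nn; rewrite /dist2.
apply: (@le_lt_trans _ _ (e / 2)); last by rewrite ltr_pdivrMr // ltr_pMr // ltr1n.
have -> : embed (s n) - cls s = cls (- 1 *: s + CSeq (const_cauchy (s n))).
  by rewrite cls_lin scaleN1r addrC.
apply: (scvg_le (N := N) _ (completion_ipP _ _)) => m Nm /=.
rewrite ltW //; have := h n m Nn Nm; rewrite /dist2.
set y := (X in G X X < _ -> _); set z := (X in _ -> G X X < _).
by have -> : z = y by rewrite /z /y addrC -scaleN1r.
Qed.

Lemma embed_dense f : exists s, converges_to completion_ip (fun n => embed (s n)) f.
Proof. by exists (rep f); rewrite -[X in converges_to _ _ X](repK f); exact: embed_converges. Qed.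

(** Choose [x n] with [embed (x n)] within [1/(n+1)] of [f n]. Then [x] is a Cauchy sequence in [M],
    and its class is the limit. *)
Lemma completion_complete (f : nat -> K) : cauchy_seq completion_ip f ->
  exists l, converges_to completion_ip f l.
Proof.
have hK := completion_ip_semi; pose nmK := semi_norm completion_ip.
move=> /(cauchy_seqP hK) cf.
have approx n : exists x, nmK (f n - embed x) < n.+1%:R^-1.
  have [s /(converges_toP hK) hs] := embed_dense (f n).
  have [|N hN] := hs n.+1%:R^-1; first by rewrite invr_gt0 ltr0n.
  by exists (s N); rewrite /nmK (semi_normC hK); exact: hN.
have [x hx] := choice approx.
have small (e : C) : 0 < e -> exists N, forall n, (N <= n)%N -> nmK (f n - embed (x n)) < e.
  move=> e0; have [N hN] := complex_archimedean (ltW (etrans (invr_gt0 e) e0)).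
  exists N => n Nn; apply: lt_trans (hx n) _.
  rewrite -[e]invrK ltf_pV2 ?posrE ?invr_gt0 ?ltr0n //.
  by apply: lt_le_trans hN _; rewrite ler_nat leqW.
have cx : (x : nat -> M) \in cauchyp hG.
  apply/asboolP/(cauchy_seqP hG) => e e0.
  have e30 : 0 < e / 3 by rewrite divr_gt0.
  have [N h] := small _ e30; have [N' h'] := cf _ e30.
  exists (maxn N N') => m n; rewrite !geq_max => /andP[mN mN'] /andP[nN nN'].
  have -> : nm (x m - x n) = nmK (embed (x m) - embed (x n)).
    by rewrite /nmK /semi_norm -(linB embed_linear) embed_ip.
  apply: le_lt_trans (semi_norm_tri hK (f n) _ _) _.
  have -> : e = e / 3 + e / 3 + e / 3 by field.
  rewrite ltrD ?h //; apply: le_lt_trans (semi_norm_tri hK (f m) _ _) _.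
  by rewrite ltrD ?h' // (semi_normC hK) h.
exists (cls (CSeq cx)); apply/(converges_toP hK) => e e0.
have e20 : 0 < e / 2 by rewrite divr_gt0.
have [N h] := small _ e20.
have /(converges_toP hK)/(_ _ e20)[N' h'] := embed_converges (CSeq cx).
exists (maxn N N') => n; rewrite geq_max => /andP[nN nN'].
apply: le_lt_trans (semi_norm_tri hK (embed (x n)) _ _) _.
by rewrite [X in _ < X]splitr ltrD ?h ?h'.
Qed.

Lemma completion_hilbert : is_hilbert completion_ip.
Proof.
have hK := completion_ip_semi; split.
- exact: (sip_lin hK).
- exact: (sip_sym hK).
- exact: (sip_ge0 hK).
- exact: completion_ip_definite.
- exact: completion_complete.
Qed.

End CompletionHilbert.

Section HilbertLimits.
Variable R : realType.
Local Notation C := R[i].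

Lemma hilbert_semi_ip (X : lmodType C) (ip : X -> X -> C) : is_hilbert ip -> semi_ip ip.
Proof. by case. Qed.

Lemma converges_unique (X : lmodType C) (ip : X -> X -> C) s l l' : is_hilbert ip ->
  converges_to ip s l -> converges_to ip s l' -> l = l'.
Proof.
move=> hX; have hS := hilbert_semi_ip hX.
move=> /(converges_toP hS) sl /(converges_toP hS) sl'; apply/eqP; rewrite -subr_eq0.
suff n0 : semi_norm ip (l - l') = 0.
  by case: hX => _ _ _ def _; apply/eqP/def; rewrite -(semi_norm_sqr ip) n0 expr0n.
apply/eqP; apply: contraT => ne.
have e0 : 0 < semi_norm ip (l - l') / 2.
  by rewrite divr_gt0 // lt_def ne semi_norm_ge0.
have [N h] := sl _ e0; have [N' h'] := sl' _ e0.
have := ltrD (h _ (leq_maxl N N')) (h' _ (leq_maxr N N')).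
rewrite -splitr (semi_normC hS) => /(le_lt_trans (semi_norm_tri hS _ _ _)).
by rewrite ltxx.
Qed.

Lemma converges_ip (X : lmodType C) (ip : X -> X -> C) s t l l' : semi_ip ip ->
  converges_to ip s l -> converges_to ip t l' ->
  scvg (fun n => ip (s n) (t n)) (ip l l').
Proof.
move=> hS sl tl.
have null r m : converges_to ip r m -> converges_to ip (fun n => r n - m) 0.
  by move=> rm e /rm[N h]; exists N => n /h; rewrite /dist2 subr0.
have e1 := sip_cvg_null hS (null _ _ sl) (converges_cauchy hS tl).
have e2 := scvg_conj (sip_cvg_null hS (null _ _ tl)
  (converges_cauchy hS (converges_to_cst hS l))).
have := scvg_lin 1 e1 (scvg_lin 1 e2 (scvg_cst (ip l l'))).
rewrite rmorph0 mulr0 !add0r; apply: (scvg_ev (N := 0%N)) => n _.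
by rewrite !mul1r -(sip_sym hS) (sipBl hS) (sipBr hS) subrK subrK.
Qed.

Definition seq_cont (X Y : lmodType C) (ipX : X -> X -> C) (ipY : Y -> Y -> C)
    (f : X -> Y) : Prop :=
  forall s l, converges_to ipX s l -> converges_to ipY (fun n => f (s n)) (f l).

Section Cont.
Variables (X Y : lmodType C) (ipX : X -> X -> C) (ipY : Y -> Y -> C).
Hypothesis hY : semi_ip ipY.

Lemma contraction_cont (f : X -> Y) : linear f ->
  (forall x, ipY (f x) (f x) <= ipX x x) -> seq_cont ipX ipY f.
Proof.
move=> lf cf s l sl e /sl[N h]; exists N => n /h; apply: le_lt_trans.
by rewrite /dist2 -(linB lf).
Qed.

Lemma cont_sum (I : finType) (a : I -> C) (f : I -> X -> Y) :
  (forall i, seq_cont ipX ipY (f i)) ->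
  seq_cont ipX ipY (fun x => \sum_i a i *: f i x).
Proof.
move=> cf s l sl.
elim: (index_enum I) => [|i r IH].
  rewrite big_nil (_ : (fun n => _) = fun _ => 0); first exact: converges_to_cst.
  by apply/funext => n; rewrite big_nil.
rewrite big_cons (_ : (fun n => _)
  = fun n => a i *: f i (s n) + \sum_(j <- r) a j *: f j (s n)).
  by apply: converges_to_lin => //; exact: cf.
by apply/funext => n; rewrite big_cons.
Qed.

End Cont.

End HilbertLimits.

(** * Extension of contractions to the completion by density *)

Section Extension.
Variables (R : realType) (M : lmodType R[i]) (G : M -> M -> R[i]).
Variable hG : semi_ip G.
Local Notation C := R[i].
Local Notation K := (completion hG).
Local Notation ipK := (@completion_ip R M G hG).
Let hK : semi_ip ipK := completion_ip_semi hG.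

Variables (Y : lmodType C) (ipY : Y -> Y -> C).
Hypothesis hilbY : is_hilbert ipY.
Let hY : semi_ip ipY := hilbert_semi_ip hilbY.

Lemma dense_eq (f g : K -> Y) : seq_cont ipK ipY f -> seq_cont ipK ipY g ->
  (forall x, f (embed hG x) = g (embed hG x)) -> forall z, f z = g z.
Proof.
move=> cf cg fg z; have [s sz] := embed_dense z.
apply: (converges_unique hilbY (cf _ _ sz)).
by rewrite (_ : (fun n => _) = fun n => g (embed hG (s n))); [exact: cg|apply/funext].
Qed.

Lemma extension (A : M -> Y) : linear A -> (forall x, ipY (A x) (A x) <= G x x) ->
  exists B : K -> Y, [/\ linear B, forall x, B (embed hG x) = A x &
    forall z, ipY (B z) (B z) <= ipK z z].
Proof.
move=> lA cA.
have lemb := embed_linear hG.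
(* The same [y] serves every approximating sequence: the difference of two of them tends to 0, and
   [A] preserves this. That uniformity makes the chosen extension linear. *)
have key (z : K) : exists y, forall s, converges_to ipK (fun n => embed hG (s n)) z ->
    converges_to ipY (fun n => A (s n)) y.
  have [s sz] := embed_dense z.
  have [y sy] : exists y, converges_to ipY (fun n => A (s n)) y.
    case: hilbY => _ _ _ _; apply => e e0.
    have [N h] := converges_cauchy hK sz e0; exists N => m n mN nN.
    apply: le_lt_trans (h m n mN nN).
    by rewrite /dist2 -(linB lA) -(linB lemb) (embed_ip hG) cA.
  exists y => t tz.
  have d0 := converges_to_lin hK (-1) sz tz; rewrite scaleN1r addNr in d0.
  have a0 : converges_to ipY (fun n => A (-1 *: s n + t n)) 0.
    move=> e /d0[N h]; exists N => n /h; apply: le_lt_trans.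
    by rewrite /dist2 !subr0 -lemb (embed_ip hG) cA.
  have := converges_to_lin hY 1 a0 sy; rewrite scale1r add0r.
  rewrite (_ : (fun n => _) = fun n => A (t n)) //; apply/funext => n.
  by rewrite scale1r lA scaleN1r addrAC addNr add0r.
have [B hB] := choice key.
exists B; split.
- move=> a z w; have [s sz] := embed_dense z; have [t tw] := embed_dense w.
  have := converges_to_lin hK a sz tw.
  rewrite (_ : (fun n => _) = fun n => embed hG (a *: s n + t n)); last first.
    by apply/funext => n; rewrite lemb.
  move=> /hB st; apply: (converges_unique hilbY st).
  rewrite (_ : (fun n => _) = fun n => a *: A (s n) + A (t n)); last first.
    by apply/funext => n; rewrite lA.
  by apply: converges_to_lin => //; exact: hB.
- move=> x; apply: (converges_unique hilbY (hB _ (fun _ => x) (converges_to_cst hK _))).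
  exact: converges_to_cst.
- move=> z; have [s sz] := embed_dense z; have sB := hB _ _ sz.
  have := scvg_lin (-1) (converges_ip hY sB sB) (converges_ip hK sz sz).
  rewrite mulN1r addrC => lim; rewrite -subr_ge0.
  apply: (scvg_ge0 (N := 0%N) _ lim) => n _.
  by rewrite mulN1r addrC subr_ge0 (embed_ip hG).
Qed.

End Extension.

(** * Structure constants and regularity *)

Section Kernels.
Variable R : realType.
Local Notation C := R[i].

Lemma kapp_kL (A B A' B' E : finType) (N : A * B -> A' * B' -> C) z p q r :
  kapp (kL (E := E) N) z (p, q, r) = \sum_a \sum_b z (a, b, r) * N (a, b) (p, q).
Proof.
transitivity (\sum_a \sum_b \sum_e z (a, b, e) * kL N (a, b, e) (p, q, r)).
  by rewrite big_triple; apply: eq_bigr => -[[]].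
apply: eq_bigr => a _; apply: eq_bigr => b _.
rewrite -(sum_delta r (fun e => z (a, b, e) * N (a, b) (p, q))).
by apply: eq_bigr => e _; rewrite /kL /= mulrA mulr_natr.
Qed.

Lemma kapp_kR (A B A' B' E : finType) (N : A * B -> A' * B' -> C) z p q r :
  kapp (kR (E := E) N) z (p, q, r) = \sum_a \sum_b z (p, a, b) * N (a, b) (q, r).
Proof.
transitivity (\sum_e \sum_a \sum_b z (e, a, b) * kR N (e, a, b) (p, q, r)).
  by rewrite big_triple; apply: eq_bigr => -[[]].
rewrite -(sum_delta p (fun e => \sum_a \sum_b z (e, a, b) * N (a, b) (q, r))).
apply: eq_bigr => e _; rewrite -sumrMnl; apply: eq_bigr => a _.
rewrite -sumrMnl; apply: eq_bigr => b _.
by rewrite /kR /= mulrCA mulr_natl.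
Qed.

Variables (k : nat) (d : 'I_k -> nat).
Variable u : forall i j : 'I_k, 'I_(d i) * 'I_(d j) -> 'I_(d i) * 'I_(d j) -> C.

(** The inverse relation for the flips makes [u^(j,i)], with pairs reversed, an inverse of
    [u^(i,j)]; by unitarity the inverse is the conjugate transpose. *)
Lemma kernel_conj (hu : forall i j : 'I_k, unitary_mx (@u i j))
  (ht_inv : forall (i j : 'I_k) (x : 'I_(d i) * 'I_(d j) -> C) a,
      kapp (tker (@u j i)) (kapp (tker (@u i j)) x) a = x a) i j r l p l' :
  @u j i (r, l) (p, l') = (@u i j (l', p) (l, r))^*.
Proof.
have inv (a0 a : 'I_(d i) * 'I_(d j)) :
    \sum_b @u i j a0 (b.2, b.1) * @u j i b (a.2, a.1) = (a0 == a)%:R.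
  have := ht_inv i j (fun c => (c == a0)%:R) a; rewrite eq_sym => <-.
  apply: eq_bigr => b _; congr (_ * _).
  rewrite /kapp -[LHS](sum_delta a0 (fun c => @u i j c (b.2, b.1))).
  by apply: eq_bigr => c _; rewrite mulr_natl.
transitivity (\sum_a0 (@u i j a0 (l, r))^* * (a0 == (l', p))%:R); last first.
  rewrite -(sum_delta (l', p) (fun a0 => (@u i j a0 (l, r))^*)).
  by apply: eq_bigr => a0 _; rewrite mulr_natr.
under eq_bigr => a0 _ do rewrite -inv mulr_sumr.
rewrite exchange_big /= -(sum_delta (r, l) (fun b => @u j i b (p, l'))).
apply: eq_bigr => -[b1 b2] _ /=.
under eq_bigr do rewrite mulrA.
by rewrite -mulr_suml (hu i j).2 mulr_natl xpair_eqE xpair_eqE andbC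
  [l == _]eq_sym [r == _]eq_sym.
Qed.

(** The associativity condition is evaluated on the basis vector indexed by [(a, b, e)] and read at
    the coordinate [(e2, b2, a2)]; the Kronecker deltas collapse the sums over the inputs. *)
Lemma kernel_braid (ht_assoc : forall (i j l : 'I_k) (x : 'I_(d l) * 'I_(d j) * 'I_(d i) -> C) a,
      kapp (kL (tker (@u j i))) (kapp (kR (tker (@u l i))) (kapp (kL (tker (@u l j))) x)) a
      = kapp (kR (tker (@u l j))) (kapp (kL (tker (@u l i))) (kapp (kR (tker (@u j i))) x)) a)
  A B D a b e a2 b2 e2 :
  \sum_a1 \sum_b1 \sum_e1
    @u B D (b, e) (b1, e1) * @u A D (a, e1) (a1, e2) * @u A B (a1, b1) (a2, b2)
  = \sum_a1 \sum_b1 \sum_e1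
    @u A B (a, b) (a1, b1) * @u A D (a1, e) (a2, e1) * @u B D (b1, e1) (b2, e2).
Proof.
pose x (t : 'I_(d A) * 'I_(d B) * 'I_(d D)) : C := (t == (a, b, e))%:R.
have := ht_assoc D B A x (e2, b2, a2); rewrite kapp_kL kapp_kR => h.
transitivity (\sum_b1 \sum_e1 kapp (kR (tker (@u A D))) (kapp (kL (tker (@u A B))) x)
   (b1, e1, a2) * tker (@u B D) (b1, e1) (e2, b2)); last first.
  rewrite [RHS]exchange_big; apply: eq_bigr => b1 _.
  rewrite [RHS]exchange_big; apply: eq_bigr => e1 _.
  rewrite kapp_kR mulr_suml; apply: eq_bigr => a1 _; congr (_ * _).
  rewrite -(sum_delta e (fun e' => @u A B (a, b) (a1, b1) * @u A D (a1, e') (a2, e1))).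
  apply: eq_bigr => e' _.
  rewrite kapp_kL -[RHS]mulrnAl; congr (_ * _).
  rewrite -(sum_delta a (fun a' => @u A B (a', b) (a1, b1) *+ (e' == e))).
  apply: eq_bigr => a' _.
  rewrite -(sum_delta b (fun b' => @u A B (a', b') (a1, b1) *+ (e' == e))) -sumrMnl.
  apply: eq_bigr => b' _; rewrite /x mulr_natl -!mulrnA !mulnb !xpair_eqE.
  by congr (_ *+ nat_of_bool _); case: (a' == a); case: (b' == b); case: (e' == e).
rewrite h; apply: eq_bigr => a1 _; apply: eq_bigr => b1 _.
rewrite kapp_kL mulr_suml.
rewrite -[LHS](sum_delta a (fun a' => \sum_e1
    @u B D (b, e) (b1, e1) * @u A D (a', e1) (a1, e2) * @u A B (a1, b1) (a2, b2))).
apply: eq_bigr => a' _; rewrite mulr_suml -sumrMnl; apply: eq_bigr => e1 _.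
rewrite -!mulrnAl; congr (_ * _ * _).
rewrite kapp_kR -(sum_delta b (fun b' => @u B D (b', e) (b1, e1) *+ (a' == a))).
apply: eq_bigr => b' _.
rewrite -(sum_delta e (fun e' => @u B D (b', e') (b1, e1) *+ (a' == a))) -sumrMnl.
apply: eq_bigr => e' _; rewrite /x mulr_natl -!mulrnA !mulnb !xpair_eqE.
by congr (_ *+ nat_of_bool _); case: (a' == a); case: (b' == b); case: (e' == e).
Qed.

End Kernels.

(** * Regularity from double commutation *)

Section RegularDilation.
Variables (R : realType) (k : nat) (d : 'I_k -> nat).
Variable u : forall i j : 'I_k, 'I_(d i) * 'I_(d j) -> 'I_(d i) * 'I_(d j) -> R[i].
Variables (K H : lmodType R[i]) (V V' : forall i : 'I_k, 'I_(d i) -> K -> K).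
Variables (T T' : forall i : 'I_k, 'I_(d i) -> H -> H) (J : H -> K) (J' : K -> H).
Hypotheses (linV' : forall i q, linear (@V' i q)) (linT' : forall i q, linear (@T' i q)).
Hypotheses (linJ : linear J) (linJ' : linear J').
Hypothesis JK : forall h, J' (J h) = h.
Hypothesis V'J : forall i q h, @V' i q (J h) = J (@T' i q h).
Hypothesis J'V : forall i q x, J' (@V i q x) = @T i q (J' x).
Hypothesis commV : forall i j : 'I_k, i != j -> forall q r x,
  @V' j r (@V i q x) = \sum_(pl : 'I_(d i) * 'I_(d j)) @u i j (q, pl.2) (pl.1, r) *: V pl.1 (V' pl.2 x).
Hypothesis commT : forall i j : 'I_k, i != j -> forall q r x,
  @T' j r (@T i q x) = \sum_(pl : 'I_(d i) * 'I_(d j)) @u i j (q, pl.2) (pl.1, r) *: T pl.1 (T' pl.2 x).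

(** The vectors [x] and [h] are built by one and the same expression, from [V] and [J] in [K] and
    from [T] in [H], using only indices in [P]. A relation is used because an [x] may have several
    such expressions. *)
Inductive twin (P : pred 'I_k) : K -> H -> Prop :=
| TwinJ h : twin P (J h) h
| TwinLin a x y h g : twin P x h -> twin P y g -> twin P (a *: x + y) (a *: h + g)
| TwinOp i q x h : P i -> twin P x h -> twin P (@V i q x) (@T i q h).

Lemma twin_sum P (I : finType) (a : I -> R[i]) (x : I -> K) (h : I -> H) :
  (forall i, twin P (x i) (h i)) -> twin P (\sum_i a i *: x i) (\sum_i a i *: h i).
Proof.
move=> xh; elim: (index_enum I) => [|i r IH]; last by rewrite !big_cons; exact: TwinLin.
by rewrite !big_nil -[X in twin P X _](lin0 linJ); exact: TwinJ.
Qed.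

Lemma twin_proj P x h : twin P x h -> J' x = h.
Proof.
elim=> [h0|a y z g g' _ yg _ zg|i q y g _ _ yg]; first exact: JK.
  by rewrite linJ' yg zg.
by rewrite J'V yg.
Qed.

(** For [j] outside [P], the adjoint moves past each operator of index in [P] with the same
    coefficients on both sides, until it meets [J], which it crosses by [V'J]. *)
Lemma twin_adjoint P x h : twin P x h -> forall j r, ~~ P j -> twin P (@V' j r x) (@T' j r h).
Proof.
elim=> [h0|a y z g g' _ yg _ zg|i q y g Pi _ yg] j r Pj.
- by rewrite V'J; exact: TwinJ.
- by rewrite linV' linT'; apply: TwinLin; [exact: yg | exact: zg].
- have ij : i != j by apply: contraNneq Pj => <-.
  rewrite commV // commT //; apply: twin_sum => -[p l] /=.
  by apply: TwinOp => //; exact: yg.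
Qed.

Lemma twin_wordop (P : pred 'I_k) n (w : words d n) x h : (forall i, (0 < n i)%N -> P i) ->
  twin P x h -> twin P (wordop V w x) (wordop T w h).
Proof.
move=> nP xh; rewrite /wordop; elim: (enum 'I_k) => //= i s IH.
have Pi (l : 'I_(d i)) ls : tval (w i) = l :: ls -> P i.
  by move=> wi; apply: nP; rewrite -(size_tuple (w i)) wi.
have : tval (w i) = [::] \/ P i.
  by case: (tval (w i)) Pi => [|l ls] Pi; [left | right; exact: Pi].
case=> [-> //|{}Pi]; elim: (tval (w i)) => //= l ls IHl.
exact: TwinOp.
Qed.

Lemma twin_wordadj (P : pred 'I_k) n (w : words d n) x h : (forall i, (0 < n i)%N -> ~~ P i) ->
  twin P x h -> twin P (wordadj V' w x) (wordadj T' w h).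
Proof.
move=> nP; rewrite /wordadj; elim: (enum 'I_k) x h => //= i s IH x h xh; apply: IH.
have Pi (l : 'I_(d i)) ls : tval (w i) = l :: ls -> ~~ P i.
  by move=> wi; apply: nP; rewrite -(size_tuple (w i)) wi.
have : tval (w i) = [::] \/ ~~ P i.
  by case: (tval (w i)) Pi => [|l ls] Pi; [left | right; exact: Pi].
case=> [-> //|{}Pi]; elim: (tval (w i)) x h xh => //= l ls IHl x h xh.
by apply: IHl; exact: twin_adjoint.
Qed.

Lemma regular_dilation n (f : words d (npos n) -> H) (w : words d (nneg n)) :
  J' (repZ V V' n (fun v => J (f v)) w) = repZ T T' n f w.
Proof.
(* The supports of [n_+] and [n_-] are disjoint: operators use indices in [P], adjoints only indices
   outside it. *)
pose P : pred 'I_k := fun i => (0 < npos n i)%N.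
apply: (@twin_proj P); apply: twin_wordadj.
  by move=> i; rewrite /P /nneg /npos; case: (n i).
rewrite /tildeop.
rewrite (eq_bigr (fun v => 1 *: wordop V v (J (f v)))) => [|v _]; last by rewrite scale1r.
rewrite [X in twin P _ X](eq_bigr (fun v => 1 *: wordop T v (f v))) => [|v _]; last by rewrite scale1r.
apply: twin_sum => v; apply: twin_wordop => //; exact: TwinJ.
Qed.

End RegularDilation.

(** * Passage to the completion *)

Section HilbertSystem.
Variables (R : realType) (k : nat) (d : 'I_k -> nat).
Variable u : forall i j : 'I_k, 'I_(d i) * 'I_(d j) -> 'I_(d i) * 'I_(d j) -> R[i].

(** The defect of linearity is orthogonal to every vector, in particular to itself, so it vanishes
    by definiteness of the target form. *)
Lemma adjoint_linear (X Y : lmodType R[i]) (ipX : X -> X -> R[i]) (ipY : Y -> Y -> R[i])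
    (A : X -> Y) (A' : Y -> X) :
  semi_ip ipX -> is_hilbert ipY -> adjoint_pair ipX ipY A A' -> linear A.
Proof.
move=> hX hilbY adjA a x y; have hY := hilbert_semi_ip hilbY.
apply/eqP; rewrite -subr_eq0; case: hilbY => _ _ _ def _; apply/eqP/def.
set z := (X in ipY _ X).
rewrite (sipBl hY) (sip_lin hY) !adjA (sip_lin hX).
exact: subrr.
Qed.

Lemma adjoint_sym (X Y : lmodType R[i]) (ipX : X -> X -> R[i]) (ipY : Y -> Y -> R[i])
    (A : X -> Y) (A' : Y -> X) :
  semi_ip ipX -> semi_ip ipY -> adjoint_pair ipX ipY A A' -> adjoint_pair ipY ipX A' A.
Proof. by move=> hX hY adjA x y; rewrite (sip_sym hX) -adjA -(sip_sym hY). Qed.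

Lemma hilbert_dc_system (H : lmodType R[i]) (ipH : H -> H -> R[i])
    (T T' : forall i : 'I_k, 'I_(d i) -> H -> H) :
  is_hilbert ipH -> (forall i, row_contraction ipH (@T i) (@T' i)) ->
  (forall i j : 'I_k, i != j -> u_doubly_commute (@u i j) (@T i) (@T' i) (@T j) (@T' j)) ->
  dc_system u ipH T T'.
Proof.
move=> hH hT hdc; have hS := hilbert_semi_ip hH; split=> //.
- by move=> i q; exact: (adjoint_linear hS hH ((hT i).1 q)).
- by move=> i q; exact: (adjoint_linear hS hH (adjoint_sym hS hS ((hT i).1 q))).
- by move=> i; exact: (hT i).1.
- move=> i x; rewrite (le_trans _ ((hT i).2 x)) // (sip_suml hS) ler_sum // => q _.
  by rewrite (hT i).1.
- move=> i j ij q r x; rewrite (hdc i j ij).1 pair_bigA /=.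
  by apply: eq_bigr => -[].
- move=> i j ij q r x; rewrite (hdc i j ij).2 pair_bigA /=.
  by apply: eq_bigr => -[].
Qed.

End HilbertSystem.

(** * The dilated system extended to the completed space *)

Section FinalExtension.
Variables (R : realType) (k : nat) (d : 'I_k -> nat).
Variable u : forall i j : 'I_k, 'I_(d i) * 'I_(d j) -> 'I_(d i) * 'I_(d j) -> R[i].
Variables (M : lmodType R[i]) (G : M -> M -> R[i]).
Variables (V V' : forall i : 'I_k, 'I_(d i) -> M -> M).
Hypothesis sysV : dc_system u G V V'.
Hypothesis isoV : forall i, isometric V V' i.
Let hG := dc_ip sysV.
Local Notation K := (completion hG).
Local Notation ipK := (@completion_ip R M G hG).
Local Notation emb := (@embed R M G hG).
Let hilbK : is_hilbert ipK := completion_hilbert hG.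
Let hK : semi_ip ipK := completion_ip_semi hG.

Lemma operator_extension : exists W W' : forall i : 'I_k, 'I_(d i) -> K -> K,
  [/\ (forall i q, linear (W i q) /\ linear (W' i q)),
      (forall i q x, W i q (emb x) = emb (V q x) /\ W' i q (emb x) = emb (V' q x)) &
      (forall i q, seq_cont ipK ipK (W i q) /\ seq_cont ipK ipK (W' i q))].
Proof.
have ext (A : M -> M) : linear A -> (forall x, G (A x) (A x) <= G x x) ->
    exists B : K -> K, [/\ linear B, (forall x, B (emb x) = emb (A x)) & seq_cont ipK ipK B].
  move=> lA cA; have [||B [lB BA cB]] := @extension _ _ _ hG _ _ hilbK (emb \o A).
  - by move=> a x y /=; rewrite lA embed_linear.
  - by move=> x /=; rewrite embed_ip.
  by exists B; split=> //; exact: contraction_cont.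
(* Packing the index and the letter into a sigma type lets a single application of [choice] produce
   the whole dependent family. *)
have exV (s : {i : 'I_k & 'I_(d i)}) : exists B : K -> K,
    [/\ linear B, (forall x, B (emb x) = emb (V (tagged s) x)) & seq_cont ipK ipK B].
  apply: ext => [|x]; first exact: (dc_lin sysV).
  by rewrite (dc_adj sysV) isoV eqxx.
have exV' (s : {i : 'I_k & 'I_(d i)}) : exists B : K -> K,
    [/\ linear B, (forall x, B (emb x) = emb (V' (tagged s) x)) & seq_cont ipK ipK B].
  apply: ext => [|x]; first exact: (dc_lin' sysV).
  (* A single adjoint is one nonnegative summand of the row contraction bound, hence contractive. *)
  apply: le_trans (dc_con sysV (tag s) x); rewrite (bigD1 (tagged s)) //= lerDl.
  by apply: sumr_ge0 => q _; exact: (sip_ge0 hG).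
have [W hW] := choice exV; have [W' hW'] := choice exV'.
exists (fun i q => W (Tagged (fun i => 'I_(d i)) q)),
  (fun i q => W' (Tagged (fun i => 'I_(d i)) q)).
split=> [i q|i q x|i q];
  by have [? ? ?] := hW (Tagged (fun i => 'I_(d i)) q);
     have [? ? ?] := hW' (Tagged (fun i => 'I_(d i)) q).
Qed.

Variables (W W' : forall i : 'I_k, 'I_(d i) -> K -> K).
Hypothesis linW : forall i q, linear (@W i q) /\ linear (@W' i q).
Hypothesis embW : forall i q x,
  @W i q (emb x) = emb (V q x) /\ @W' i q (emb x) = emb (V' q x).
Hypothesis contW : forall i q, seq_cont ipK ipK (@W i q) /\ seq_cont ipK ipK (@W' i q).

Lemma ext_adjoint i q : adjoint_pair ipK ipK (@W i q) (@W' i q).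
Proof.
move=> x y; have [s sx] := embed_dense x; have [t ty] := embed_dense y.
have [cW cW'] := contW q.
apply: (scvg_unique (converges_ip hK (cW _ _ sx) ty)).
apply: (scvg_ev (N := 0%N) _ (converges_ip hK sx (cW' _ _ ty))) => n _.
have [-> _] := embW q (s n); have [_ ->] := embW q (t n).
by rewrite !embed_ip (dc_adj sysV).
Qed.

Lemma ext_isometric : forall i, isometric W W' i.
Proof.
move=> i q r.
have c1 : seq_cont ipK ipK (fun x => W' q (W r x)).
  by move=> s l /(contW r).1/(contW q).2.
have c2 : seq_cont ipK ipK (fun x => x *+ (q == r)).
  by move=> s l sl; case: (q == r) => //; exact: converges_to_cst.
apply: (dense_eq hilbK c1 c2) => x.
have [-> _] := embW r x; have [_ ->] := embW q (V r x); rewrite isoV.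
by case: (q == r) => //=; exact: (lin0 (embed_linear hG)).
Qed.

Lemma ext_row_isometry i : row_isometry ipK (@W i) (@W' i).
Proof.
split; first split.
- exact: ext_adjoint.
- move=> x; rewrite (sip_suml hK); under eq_bigr do rewrite ext_adjoint.
  apply: (isometries_contraction hK) (x) => [q|q y z|]; first exact: (linW q).2.
    exact: ext_adjoint.
  exact: ext_isometric.
- by move=> q x; rewrite ext_adjoint ext_isometric eqxx.
Qed.

Lemma ext_doubly_commute i j : i != j ->
  u_doubly_commute (@u i j) (@W i) (@W' i) (@W j) (@W' j).
Proof.
move=> ij; split=> q r.
  have c1 : seq_cont ipK ipK (fun x => W q (W r x)).
    by move=> s l /(contW r).1/(contW q).1.
  apply: (dense_eq hilbK c1).
    apply: (cont_sum hK) => -[p l] /=.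
    by move=> s z /(contW p).1/(contW l).1.
  move=> x; have [-> _] := embW r x; have [-> _] := embW q (V r x).
  rewrite (dc_comm sysV) // pair_bigA /= (lin_sum (embed_linear hG)).
  apply: eq_bigr => -[p l] _ /=; rewrite (linZ (embed_linear hG)).
  by have [-> _] := embW p x; have [-> _] := embW l (V p x).
have c1 : seq_cont ipK ipK (fun x => W' r (W q x)).
  by move=> s l /(contW q).1/(contW r).2.
apply: (dense_eq hilbK c1).
  apply: (cont_sum hK) => -[p l] /=.
  by move=> s z /(contW l).2/(contW p).1.
move=> x; have [-> _] := embW q x; have [_ ->] := embW r (V q x).
rewrite (dc_comm' sysV) // pair_bigA /= (lin_sum (embed_linear hG)).
apply: eq_bigr => -[p l] _ /=; rewrite (linZ (embed_linear hG)).
by have [_ ->] := embW l x; have [-> _] := embW p (V' l x).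
Qed.

End FinalExtension.

Section Projection.
Variables (R : realType) (M H : lmodType R[i]) (G : M -> M -> R[i]) (F : H -> H -> R[i]).
Variables (J : H -> M) (J' : M -> H).
Hypotheses (hG : semi_ip G) (hilbH : is_hilbert F).
Hypotheses (adjJ : adjoint_pair F G J J') (JK : forall h, J' (J h) = h).
Local Notation K := (completion hG).
Local Notation ipK := (@completion_ip R M G hG).
Local Notation emb := (@embed R M G hG).
Let hK : semi_ip ipK := completion_ip_semi hG.
Let hF : semi_ip F := hilbert_semi_ip hilbH.

(** Since [J' J] is the identity, [J] is isometric, so Cauchy-Schwarz for [J (J' x)] and [x] makes
    [J'] contractive. It extends to the completion, and adjointness passes to limits. *)
Lemma projection_extension : exists Q : K -> H,
  [/\ linear Q, adjoint_pair F ipK (emb \o J) Q & forall h, Q (emb (J h)) = h].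
Proof.
have adjJ' := adjoint_sym hF hG adjJ.
have lJ' : linear J' by exact: (adjoint_linear hG hilbH adjJ').
have cJ' x : F (J' x) (J' x) <= G x x.
  have := sip_ge0 hF (J' x); rewrite le_eqVlt => /predU1P[<-|pos].
    exact: (sip_ge0 hG).
  have := cauchy_schwarz hG (J (J' x)) x; rewrite !adjJ JK ger0_norm ?(ltW pos) //.
  by rewrite expr2 ler_pM2l.
have [Q [lQ QJ cQ]] := @extension _ _ _ hG _ _ hilbH J' lJ' cJ'.
exists Q; split=> [//|h z|h]; last by rewrite QJ.
have [s sz] := embed_dense z.
have cQ' : seq_cont ipK F Q by exact: contraction_cont.
apply: (scvg_unique (converges_ip hK (converges_to_cst hK (emb (J h))) sz)).
apply: (scvg_ev (N := 0%N) _ (converges_ip hF (converges_to_cst hF h) (cQ' _ _ sz))) => n _.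
by rewrite embed_ip QJ adjJ.
Qed.

End Projection.

(** * Assembly of the regular dilation on the completed space *)

Theorem theorem4p8
  (R : realType) (H : lmodType R[i]) (ipH : H -> H -> R[i])
  (hH : is_hilbert ipH)
  (k : nat) (d : 'I_k -> nat) (hd : forall i : 'I_k, (0 < d i)%N)
  (u : forall i j : 'I_k, 'I_(d i) * 'I_(d j) -> 'I_(d i) * 'I_(d j) -> R[i])
  (hu : forall i j : 'I_k, unitary_mx (u i j))
  (ht_id : forall (i : 'I_k) (x : 'I_(d i) * 'I_(d i) -> R[i]) a,
      kapp (tker (u i i)) x a = x a)
  (ht_inv : forall (i j : 'I_k) (x : 'I_(d i) * 'I_(d j) -> R[i]) a,
      kapp (tker (u j i)) (kapp (tker (u i j)) x) a = x a)
  (ht_assoc : forall (i j l : 'I_k) (x : 'I_(d l) * 'I_(d j) * 'I_(d i) -> R[i]) a,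
      kapp (kL (tker (u j i))) (kapp (kR (tker (u l i))) (kapp (kL (tker (u l j))) x)) a
      = kapp (kR (tker (u l j))) (kapp (kL (tker (u l i))) (kapp (kR (tker (u j i))) x)) a)
  (T Tadj : forall i : 'I_k, 'I_(d i) -> H -> H)
  (hT : forall i : 'I_k, row_contraction ipH (T i) (Tadj i))
  (hTdc : forall i j : 'I_k, i != j ->
      u_doubly_commute (u i j) (T i) (Tadj i) (T j) (Tadj j)) :
  exists (K : lmodType R[i]) (ipK : K -> K -> R[i]) (J : H -> K) (Jadj : K -> H)
         (V Vadj : forall i : 'I_k, 'I_(d i) -> K -> K),
    [/\ is_hilbert ipK,
        adjoint_pair ipH ipK J Jadj /\ (forall x y : H, ipK (J x) (J y) = ipH x y),
        (forall i : 'I_k, row_isometry ipK (V i) (Vadj i)),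
        (forall i j : 'I_k, i != j ->
            u_doubly_commute (u i j) (V i) (Vadj i) (V j) (Vadj j)) &
        [/\ (forall (i : 'I_k) (l : 'I_(d i)) (h : H), exists h' : H, Vadj i l (J h) = J h'),
            (forall (n : 'I_k -> int) (f : words d (npos n) -> H) (w : words d (nneg n)),
                Jadj (repZ V Vadj n (fun v => J (f v)) w) = repZ T Tadj n f w) &
            (forall S : K -> Prop, closed_subspace ipK S ->
                (forall h : H, S (J h)) ->
                (forall (i : 'I_k) (l : 'I_(d i)) (x : K), S x -> S (V i l x)) ->
                forall x : K, S x)]].
Proof.
have sysT := hilbert_dc_system hH hT hTdc.
have hF := hilbert_semi_ip hH.
have [M [G [J [J' [V [V' [sysV linJ [adjJ JK] V'J [iso span]]]]]]]] :=
  dilation_stage (@complex_archimedean R) (kernel_conj hu ht_inv)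
    (fun i j => (hu i j).1) (kernel_braid ht_assoc) sysT (leqnn k).
have isoV i : isometric V V' i by apply: iso; exact: ltn_ord.
have [W [W' [linW embW contW]]] := operator_extension sysV isoV.
have [Q [linQ adjQ QJ]] := projection_extension (dc_ip sysV) hH adjJ JK.
have hK := completion_ip_semi (dc_ip sysV).
have adjW := ext_adjoint embW contW.
have W'J i q h : W' i q (embed (dc_ip sysV) (J h)) = embed (dc_ip sysV) (J (Tadj i q h)).
  by have [_ ->] := embW i q (J h); rewrite V'J.
(* This is the adjoint of [W'J]: both sides have the same inner product with every vector of [H]. *)
have QW i q x : Q (W i q x) = T i q (Q x).
  apply/eqP; rewrite -subr_eq0; case: (hH) => _ _ _ def _; apply/eqP/def.
  set z := (X in ipH _ X).
  rewrite (sipBl hF) (dc_adj sysT) ![ipH (Q _) _](sip_sym hF) -!adjQ /=.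
  rewrite -W'J (adjoint_sym hK hK (adjW i q)).
  exact: subrr.
have dcW := ext_doubly_commute embW contW.
exists (completion (dc_ip sysV)), (@completion_ip R M G (dc_ip sysV)),
  (embed (dc_ip sysV) \o J), Q, W, W'; split=> //.
- exact: completion_hilbert.
- by split=> // x y /=; rewrite embed_ip adjJ JK.
- exact: (ext_row_isometry isoV linW embW contW).
split.
- by move=> i l h; exists (Tadj i l h); exact: W'J.
- apply: (@regular_dilation _ _ _ u) => //.
  + by move=> i q; exact: (linW i q).2.
  + exact: (dc_lin' sysT).
  + by move=> a x y /=; rewrite linJ embed_linear.
  + by move=> i j ij; exact: (dcW i j ij).2.
  + by move=> i j ij; exact: (hTdc i j ij).2.
- move=> S [S0 SD SZ Scl] SJ SW x; have [s sx] := embed_dense x.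
  (* By density and closedness only embedded vectors need be reached, and those lie in the algebraic
     span. *)
  apply: (Scl _ _ _ sx) => m.
  apply: (span (fun y => S (embed (dc_ip sysV) y))) => [a y z Sy Sz|h|i _ q y Sy].
  + by rewrite embed_linear; apply: SD => //; exact: SZ.
  + exact: SJ.
  + by have [<- _] := embW i q y; exact: SW.
Qed.
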